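(* Consider an arbitrary $q$-state spin system, with $n=|V|\ge2$, on a graph of maximum degree $\Delta$. If the system is $\eta$-spectrally independent and $b$-marginally bounded, then general block factorization of entropy holds with a constant $C=C(b,\eta,\Delta)$: for all probability distributions $\alpha=(\alpha_B)_{B\subset V}$ over subsets of $V$ and all $f:\Omega\to\mathbb R_+$, $$\delta(\alpha)\,\mathrm{Ent}(f)\le C\sum_{B\subset V}\alpha_B\,\mu[\mathrm{Ent}_B(f)].$$ The constant satisfies $C=\left(\frac2b\right)^{O\left(\Delta(1+\frac{\eta}{b})\right)}$, the implied constant in $O(\cdot)$ being absolute. Moreover, all heat-bath block dynamics have optimal mixing and optimal entropy decay: there is a constant $C'$, depending only on $b,\eta,\Delta$, such that for every $\alpha$ the $\alpha$-weighted heat-bath block dynamics has mixing time at most $C'\delta(\alpha)^{-1}\log n$ and modified log-Sobolev constant at least $\delta(\alpha)/C'$.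
   Context: Spin system. Let $q\ge2$, $[q]=\{1,\dots,q\}$, and let $G=(V\cup\partial V,E\cup\partial E)$ be a finite graph, where $\partial V$ is a (possibly empty) boundary set, $E$ is the set of edges inside $V$ and $\partial E$ the set of edges between $V$ and $\partial V$; $n=|V|$. Given nonnegative symmetric matrices $A_{xy}\in\mathbb R_+^{q\times q}$ for $\{x,y\}\in E\cup\partial E$, vectors $B_x\in\mathbb R_+^q$ for $x\in V$, and a boundary condition $\xi\in[q]^{\partial V}$, a configuration $\sigma\in[q]^V$ has weight $w(\sigma)=\prod_{\{x,y\}\in E}A_{xy}(\sigma_x,\sigma_y)\prod_{\{x,y\}\in\partial E,\,x\in V,\,y\in\partial V}A_{xy}(\sigma_x,\xi_y)\prod_{x\in V}B_x(\sigma_x)$. Let $\Omega=\{\sigma:w(\sigma)>0\}$ (assumed nonempty); the Gibbs distribution is $\mu(\sigma)\propto w(\sigma)$ on $\Omega$. Pinnings. For $U\subset V$, $\Omega_U$ is the set of $\tau\in[q]^U$ that extend to an element of $\Omega$; a pinning is an element $\tau$ of $\bigcup_U\Omega_U$. For $\tau\in\Omega_U$, $\mu^\tau=\mu(\cdot\mid\sigma_U=\tau)$, with support $\Omega^\tau$; $\Omega_x^\tau$ is the set of spins possible at $x$ under $\mu^\tau$; $\mathcal X^\tau=\{(x,a):x\in V\setminus U,a\in\Omega^\tau_x\}$. Standing assumption: $\mu$ is totally-connected, i.e. for every pinning $\tau$ the set $\Omega^\tau$ is connected under moves between configurations at Hamming distance 1. Influence matrix: $J^\tau\in\mathbb R^{\mathcal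 X^\tau\times\mathcal X^\tau}$ with $J^\tau(x,a;x,a')=0$ and $J^\tau(x,a;y,a')=\mu^\tau(\sigma_y=a'\mid\sigma_x=a)-\mu^\tau(\sigma_y=a')$ for $x\ne y$; its eigenvalues are real. The system is $\eta$-spectrally independent if the largest eigenvalue satisfies $\lambda_1(J^\tau)\le\eta$ for all pinnings $\tau$. It is $b$-marginally bounded ($b>0$) if $\mu^\tau(\sigma_x=a)\ge b$ for all pinnings $\tau$, all $x\in V$ and all $a\in\Omega_x^\tau$. Entropy: $\mathrm{Ent}(f)=\mu[f\log(f/\mu[f])]$. For $B\subset V$, $\mu_B$ is the conditional distribution of $\mu$ given the spins outside $B$, $\mu_B[f]$ is a function of $\sigma_{V\setminus B}$, and $\mu[\mathrm{Ent}_B(f)]=\mu[f\log(f/\mu_B[f])]$. Put $\delta(\alpha)=\min_{x\in V}\sum_{B:B\ni x}\alpha_B$ (bounds involving $\delta(\alpha)^{-1}$ are vacuous if $\delta(\alpha)=0$). The $\alpha$-weighted heat-bath block dynamics chooses in each step a block $B$ with probability $\alpha_B$ and resamples the configuration in $B$ from $\mu$ conditioned on the current configuration on $V\setminus B$. Mixing time: $T_{\rm mix}(P)=\max_{X_0\in\Omega}\min\{t\ge0:\|P^t(X_0,\cdot)-\mu\|_{TV}\le 1/4\}$. The modified log-Sobolev constant is the largest $\rho$ with $\mu[f(1-P)\log f]\ge\rho\,\mathrm{Ent}(f)$ for all $f\ge0$ (usual limiting conventions where $f$ vanishes). *)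

(* Defs.v *)
From mathcomp Require Import all_boot all_order all_algebra.
From mathcomp Require Import all_classical all_reals all_analysis.

Set Implicit Arguments.
Unset Strict Implicit.
Unset Printing Implicit Defensive.

Import Order.TTheory GRing.Theory Num.Theory.
Local Open Scope ring_scope.

(* V is the set of interior vertices, W plays the role of the boundary. The
   interaction of an edge does not depend on the orientation of the edge, and
   only its values on edges matter. *)
Record spin_system (R : realType) (q : nat) (V W : finType) := SpinSystem {
  adj : rel (V + W)%type;
  adj_sym : symmetric adj;
  adj_irrefl : irreflexive adj;
  adj_boundary : forall y z : W, ~~ adj (inr y) (inr z);
  interaction : (V + W)%type -> (V + W)%type -> 'M[R]_q;
  interaction_ge0 :
    forall u v, adj u v -> forall a c, 0 <= interaction u v a c;
  interaction_sym : forall u v, adj u v -> (interaction u v)^T = interaction u v;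
  interaction_edge : forall u v, adj u v -> interaction v u = interaction u v;
  vertex_weight : V -> 'I_q -> R;
  vertex_weight_ge0 : forall x a, 0 <= vertex_weight x a;
  boundary_condition : W -> 'I_q }.

Section SpinSystem.
Context {R : realType} {q : nat} {V W : finType}.
Variable S : spin_system R q V W.

Definition max_degree : nat :=
  \max_(u : (V + W)%type) #|[set v : (V + W)%type | adj S u v]|.

Definition config := {ffun V -> 'I_q}.

(* In the first product each unordered edge {x, y} of the interior is counted
   once, through its orientation that is increasing for enum_rank. *)
Definition weight (s : config) : R :=
  (\prod_(e : V * V | adj S (inl e.1) (inl e.2) &&
                      (enum_rank e.1 < enum_rank e.2)%N)
      interaction S (inl e.1) (inl e.2) (s e.1) (s e.2)) *
  (\prod_(e : V * W | adj S (inl e.1) (inr e.2))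
      interaction S (inl e.1) (inr e.2) (s e.1) (boundary_condition S e.2)) *
  \prod_(x : V) vertex_weight S x (s x).

Definition Omega : Type := {s : config | 0 < weight s}.

Definition partition_function : R := \sum_(s : Omega) weight (val s).
Definition mu (s : Omega) : R := weight (val s) / partition_function.

Definition mean (f : Omega -> R) : R := \sum_(s : Omega) mu s * f s.
Definition Pr (P : pred Omega) : R := \sum_(s : Omega | P s) mu s.
Definition condPr (P Q : pred Omega) : R := Pr (predI P Q) / Pr Q.

(* A partial configuration assigns a spin to the vertices x of a subset U with
   tau x = Some a, and None to the vertices outside U. *)
Definition partial_config := {ffun V -> option 'I_q}.

Definition extends (tau : partial_config) : pred Omega :=
  fun s => [forall x, (tau x == None) || (tau x == Some (val s x))].

Definition pinning (tau : partial_config) : bool := [exists s : Omega, extends tau s].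

Definition spin_at (x : V) (a : 'I_q) : pred Omega := fun s => val s x == a.

Definition spins (tau : partial_config) (x : V) : {set 'I_q} :=
  [set a | [exists s : Omega, extends tau s && spin_at x a s]].

Definition hamming (s t : Omega) : nat := #|[set x | val s x != val t x]|.

Definition totally_connected : Prop :=
  forall tau, pinning tau -> forall s t, extends tau s -> extends tau t ->
    connect [rel u v | [&& extends tau u, extends tau v & hamming u v == 1%N]]
      s t.

Definition muP (tau : partial_config) (P : pred Omega) : R :=
  condPr P (extends tau).
Definition cond_muP (tau : partial_config) (P Q : pred Omega) : R :=
  muP tau (predI P Q) / muP tau Q.

Definition feasible_pairs (tau : partial_config) : {set V * 'I_q} :=
  [set p | (tau p.1 == None) && (p.2 \in spins tau p.1)].

Definition influence_entry (tau : partial_config) (p p' : V * 'I_q) : R :=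
  if p.1 == p'.1 then 0
  else cond_muP tau (spin_at p'.1 p'.2) (spin_at p.1 p.2) -
       muP tau (spin_at p'.1 p'.2).

Definition influence_matrix (tau : partial_config) : 'M[R]_#|feasible_pairs tau| :=
  \matrix_(i, j) influence_entry tau (enum_val i) (enum_val j).

(* For a pinning of all of V the matrix is empty and has no eigenvalue. *)
Definition spectrally_independent (eta : R) : Prop :=
  forall tau, pinning tau ->
    forall lambda, eigenvalue (influence_matrix tau) lambda -> lambda <= eta.

Definition marginally_bounded (b : R) : Prop :=
  0 < b /\
  forall tau, pinning tau ->
    forall x a, a \in spins tau x -> b <= muP tau (spin_at x a).

(* The convention 0 log 0 = 0 is built in: f s = 0 makes the term vanish, and
   if f s > 0 then the mean dividing f s is positive as well. *)
Definition Ent (f : Omega -> R) : R := mean (fun s => f s * ln (f s / mean f)).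

Definition agree_off (D : {set V}) (s t : Omega) : bool :=
  [forall x, (x \notin D) ==> (val s x == val t x)].

Definition mu_block (D : {set V}) (s t : Omega) : R :=
  if agree_off D s t then mu t / Pr (agree_off D s) else 0.

Definition mean_block (D : {set V}) (f : Omega -> R) (s : Omega) : R :=
  \sum_(t : Omega) mu_block D s t * f t.

(* This is mu[Ent_D(f)]. *)
Definition mean_Ent_block (D : {set V}) (f : Omega -> R) : R :=
  mean (fun s => f s * ln (f s / mean_block D f s)).

Definition block_distribution (alpha : {set V} -> R) : Prop :=
  (forall D, 0 <= alpha D) /\ \sum_(D : {set V}) alpha D = 1.

(* The sums are at most 1 for a probability distribution alpha, hence the
   default value 1 does not affect the minimum. *)
Definition delta (alpha : {set V} -> R) : R :=
  \big[Num.min/1]_(x : V) \sum_(D : {set V} | x \in D) alpha D.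

Definition block_factorization (C : R) : Prop :=
  forall alpha, block_distribution alpha ->
  forall f : Omega -> R, (forall s, 0 <= f s) ->
    delta alpha * Ent f <=
    C * \sum_(D : {set V}) alpha D * mean_Ent_block D f.

Definition block_dynamics (alpha : {set V} -> R) (s t : Omega) : R :=
  \sum_(D : {set V}) alpha D * mu_block D s t.

Section Chain.
Variable P : Omega -> Omega -> R.

Fixpoint kernel_iter (n : nat) (s t : Omega) : R :=
  if n is m.+1 then \sum_(u : Omega) P s u * kernel_iter m u t
  else (s == t)%:R.

Definition tv_to_mu (n : nat) (s : Omega) : R :=
  2^-1 * \sum_(t : Omega) `|kernel_iter n s t - mu t|.

(* The infimum over an empty set of times is +oo. *)
Definition mixing_time : \bar R :=
  \big[maxe/0%E]_(s : Omega)
    ereal_inf [set (n%:R)%:E | n in [set n : nat | tv_to_mu n s <= 4^-1]].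

(* mu[f (1 - P) log f] as an extended real. Since log 0 = -oo and 0 * -oo = 0,
   a state s with f s = 0 contributes 0, and a state s with f s > 0
   contributes +oo as soon as P s t > 0 for some t with f t = 0; this is the
   limit of the same expression for f + epsilon. *)
Definition entropy_production (f : Omega -> R) : \bar R :=
  (\sum_(s : Omega) (mu s)%:E * ((f s)%:E *
     (lne (f s)%:E - \sum_(t : Omega) (P s t)%:E * lne (f t)%:E)))%E.

(* The supremum is +oo when Omega is a single configuration, in which case
   every rho is admissible. *)
Definition modified_log_sobolev : \bar R :=
  ereal_sup [set rho%:E | rho in [set rho : R |
    forall f : Omega -> R, (forall s, 0 <= f s) ->
      ((rho * Ent f)%:E <= entropy_production f)%E]].

End Chain.
End SpinSystem.

Arguments block_dynamics {R q V W} S alpha s t.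

(* Main.v *)
(* Write h(D) for the mean entropy of f on the block D. The local-to-global
   step: for distinct u and v the second differences of h are controlled by
   x ln (x / y) >= x - y, and their sum over u <> v by the quadratic form of the
   influence matrix; the marginal bound turns the resulting variances into
   entropies. This gives
     sum_(u in D) (h(D) - h(D minus u)) <= (1 + 4 eta / b) h(D)  for all D,
   hence theta^N h(V) <= E h(A) for a Bernoulli(theta) random set A, where
   N >= 1 + 4 eta / b.
     Take theta = (2 / b)^(- 16 Delta). The components of A are small, and on a
   component of size s the entropy is at most (2 / b)^(12 (s - 1)) times the sum
   of the single-site entropies, by a path argument. Deleting from A all but one
   vertex of a component and counting connected sets yields
   E h(A) <= 2 E h(I), with I the set of isolated vertices of A.
     The set I is independent, so mu conditioned outside I is a product measure,
   h is submodular on the subsets of I, and a Shearer type inequality gives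
   delta(alpha) h(I) <= sum_B alpha_B h(B :&: I) <= sum_B alpha_B h(B).
     The entropy decay of the dynamics follows by convexity, the modified
   log-Sobolev inequality by concavity of ln, and the mixing time bound from
   mu >= b^n together with a Pinsker type inequality. *)
Require Import Defs.
From mathcomp Require Import all_boot all_order all_algebra.
From mathcomp Require Import complex spectral.
From mathcomp Require Import all_classical all_reals all_analysis.
From mathcomp Require Import ring lra zify.

Set Implicit Arguments.
Unset Strict Implicit.
Unset Printing Implicit Defensive.

Import mathcomp.boot.fintype mathcomp.boot.finset.
Import Order.TTheory GRing.Theory Num.Theory.
Local Open Scope ring_scope.

(** * Quadratic forms of symmetric and reversible matrices *)

Section Rayleigh.
Context {R : realType}.
Local Open Scope sesquilinear_scope.
Local Notation C := (complex R).

(** Two obstacles shape the proof. Shearer's inequality needs submodularity of h, which is available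
    only for increments by blocks without an edge to the set they are added to; and comparing a
    block with its single sites through total connectivity loses a factor exponential in the size of
    the block. A sparse random set avoids both, but its price must not depend on n. This is why the
    local-to-global step bounds the sum of all first differences of h: minus that sum is the
    generator of the process deleting each vertex at rate 1, whose law at time t, started from V, is
    Bernoulli(exp(- t)). A bound by N h thus means decay at rate at most N, that is theta^N h(V) <=
    E h(A), however large V is. For each further vertex of a component, theta must beat both the
    crude cost (2 / b)^12 and the factor Delta^2 from counting connected sets; the total cost of the
    components is then a convergent geometric series. *)

Lemma symmetric_rayleigh_le n (M : 'M[R]_n) (eta : R) (x : 'rV[R]_n) :
  M^T = M -> (forall l, eigenvalue M l -> l <= eta) ->
  (x *m M *m x^T) 0 0 <= eta * (x *m x^T) 0 0.
Proof.
move=> Msym Meta.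
pose rc := (real_complex R : {rmorphism R -> C}).
pose A := map_mx rc M.
have cj (r : R) : (rc r)^* = rc r by exact: conjc_real.
have Areal : A \is a realmx.
  by apply/mxOverP=> i j; rewrite mxE; apply/CrealP; exact: cj.
have Aherm : A \is hermsymmx.
  apply: realsym_hermsym => //; apply/is_hermitianmxP.
  by rewrite expr0 scale1r map_mx_id // /A map_trmx Msym.
have Dreal := hermitian_spectral_diag_real Aherm.
have /orthomx_spectralP := hermitian_normalmx Aherm.
have := spectral_unitarymx A.
move: Dreal; set P := spectralmx A; set d := spectral_diag A => Dreal Pu AE.
have Pun : P \in unitmx := unitarymx_unit Pu.
(* [d 0 j] is real and row [j] of [P] is an eigenvector for it; as a root of the characteristic
   polynomial that [A] shares with [M], it is an eigenvalue of the real matrix. *)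
have dE j : exists2 r : R, d 0 j = rc r & r <= eta.
  have /mxOverP/(_ 0 j) dr := Dreal.
  exists (complex.Re (d 0 j)); first by rewrite /rc /= RRe_real.
  apply: Meta; rewrite eigenvalue_root_char -(fmorph_root rc).
  rewrite map_char_poly -eigenvalue_root_char -/A /rc /= RRe_real //.
  apply/eigenvalueP; exists (row j P).
    rewrite {1}AE !mulmxA -row_mul mulmxV //.
    rewrite row1 -rowE.
    by rewrite row_diag_mx -scalemxAl -rowE.
  apply/negP => /eqP r0; have : (row j P *m invmx P) = 0 by rewrite r0 mul0mx.
  rewrite -row_mul mulmxV // row1 => /matrixP /(_ 0 j).
  by rewrite !mxE !eqxx => /eqP; rewrite oner_eq0.
pose xc := map_mx rc x; pose z := xc *m P^t*.
have zE : z^t* = P *m xc^T.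
  rewrite /z trmx_mul map_mxM trmxCK; congr (_ *m _).
  by apply/matrixP => i j; rewrite !mxE; exact: cj.
have invP : invmx P = P^t* by apply: invmx_unitary.
have Q1 : rc ((x *m M *m x^T) 0 0) = (z *m diag_mx d *m z^t*) 0 0.
  rewrite zE /z -invP !mulmxA -(mulmxA xc) -(mulmxA xc (invmx P *m _)) -AE.
  have -> : xc^T = map_mx rc x^T by rewrite map_trmx.
  by rewrite -!map_mxM [RHS]mxE.
have Q2 : rc ((x *m x^T) 0 0) = (z *m z^t*) 0 0.
  rewrite zE /z -invP -!mulmxA mulKmx //.
  have -> : xc^T = map_mx rc x^T by rewrite map_trmx.
  by rewrite -!map_mxM [RHS]mxE.
suff : rc ((x *m M *m x^T) 0 0) <= rc eta * rc ((x *m x^T) 0 0).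
  by rewrite -rmorphM /= lecR.
rewrite Q1 Q2 !mxE mulr_sumr; apply: ler_sum => j _.
have -> : (z *m diag_mx d) 0 j = z 0 j * d 0 j.
  rewrite mul_mx_diag mxE //.
have [r -> rle] := dE j.
rewrite mulrAC mulrC; apply: ler_wpM2r; last by rewrite lecR.
by rewrite !mxE mul_conjC_ge0.
Qed.

(* Conjugating J by the square roots of w makes it symmetric. *)
Lemma reversible_rayleigh_le n (J : 'M[R]_n) (w : 'I_n -> R) (eta : R)
    (phi : 'I_n -> R) :
  (forall i, 0 < w i) -> (forall i j, w i * J i j = w j * J j i) ->
  (forall l, eigenvalue J l -> l <= eta) ->
  \sum_i \sum_j w i * J i j * (phi i * phi j) <= eta * \sum_i w i * phi i ^+ 2.
Proof.
move=> w0 Jrev Jeta.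
pose sw i := Num.sqrt (w i).
have sw0 i : 0 < sw i by rewrite sqrtr_gt0.
have swE i : sw i * sw i = w i by rewrite -expr2 sqr_sqrtr ?ltW.
pose M := \matrix_(i, j) (sw i * J i j / sw j).
have swn i : sw i != 0 by rewrite gt_eqF.
have Msym : M^T = M.
  apply/matrixP => i j; rewrite !mxE.
  apply: (mulfI (swn i)); apply: (mulIf (swn j)).
  transitivity (w j * J j i); first by rewrite -swE; field; apply: swn.
  by rewrite Jrev -swE; field; apply: swn.
have Meta l : eigenvalue M l -> l <= eta.
  move=> /eigenvalueP[v vM vn0]; apply: Jeta; apply/eigenvalueP.
  exists (\row_i (v 0 i * sw i)).
    apply/matrixP => i0 j; rewrite !mxE.
    have /matrixP /(_ 0 j) := vM; rewrite !mxE => e.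
    rewrite mulrA -e mulr_suml; apply: eq_bigr => i _; rewrite !mxE.
    by field; apply: swn.
  apply: contraNneq vn0 => /matrixP v0; apply/eqP/matrixP => i j.
  have := v0 0 j; rewrite !mxE (ord1 i) => /eqP.
  by rewrite mulf_eq0 (negbTE (swn j)) orbF => /eqP.
have := @symmetric_rayleigh_le n M eta (\row_i (phi i * sw i)) Msym Meta.
rewrite !mxE => H.
have -> : \sum_i \sum_j w i * J i j * (phi i * phi j) =
   \sum_j (\row_i (phi i * sw i) *m M) 0 j * ((\row_i (phi i * sw i))^T) j 0.
  rewrite exchange_big /=; apply: eq_bigr => j _; rewrite !mxE mulr_suml.
  apply: eq_bigr => i _; rewrite !mxE -swE; field; exact: swn.
apply: (le_trans H); rewrite le_eqVlt; apply/orP; left; apply/eqP.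
by congr (_ * _); apply: eq_bigr => i _; rewrite !mxE -swE; ring.
Qed.

End Rayleigh.

(** * Components and isolated vertices of induced subgraphs *)

Section Components.
Context {R : realType} {V : finType}.
Variable e : rel V.
Hypothesis e_sym : symmetric e.
Hypothesis e_irr : irreflexive e.
Implicit Types (A B D I : {set V}) (u v : V).

Definition induced A : rel V := [rel x y | [&& x \in A, y \in A & e x y]].
Definition component A u : {set V} := [set v | connect (induced A) u v].
Definition isolated_vertices A : {set V} := [set u in A | [forall v in A, ~~ e u v]].
(** For spin systems, this relation makes the spins on [D] and on [A] conditionally independent
    given the rest. *)
Definition unlinked D A : bool :=
  [disjoint D & A] && [forall x in D, forall y in A, ~~ e x y].

Lemma unlinkedP D A :
  reflect (forall x y, x \in D -> y \in A -> x != y /\ ~~ e x y) (unlinked D A).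
Proof.
apply: (iffP andP) => [[/pred0P dis /forall_inP na] x y xD yA|H].
  split; last by have /forall_inP := na _ xD; apply.
  by apply: contraTneq yA => <-; have := dis x; rewrite /= xD /= => ->.
split.
  apply/pred0P => x /=; apply/negP => /andP[xD xA].
  by have [] := H _ _ xD xA; rewrite eqxx.
apply/forall_inP => x xD; apply/forall_inP => y yA.
by have [] := H _ _ xD yA.
Qed.

Lemma unlinkedC D A : unlinked D A = unlinked A D.
Proof.
by apply/unlinkedP/unlinkedP => H x y xD yA; rewrite eq_sym e_sym; apply: H.
Qed.

Lemma unlinkedS D A D' A' : D' \subset D -> A' \subset A ->
  unlinked D A -> unlinked D' A'.
Proof.
move=> /subsetP DD /subsetP AA /unlinkedP H; apply/unlinkedP => x y xD yA.
by apply: H; [apply: DD | apply: AA].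
Qed.

Lemma induced_sym A : connect_sym (induced A).
Proof.
apply: sym_connect_sym => x y; rewrite /induced /= e_sym.
by case: (x \in A); case: (y \in A).
Qed.

Lemma component_refl A u : u \in component A u.
Proof. by rewrite inE connect0. Qed.

Lemma component_sub A u : u \in A -> component A u \subset A.
Proof.
move=> uA; apply/subsetP => v; rewrite inE => /connectP[p pP ->].
elim: p u uA pP => //= w p IH u uA /andP[/and3P[_ wA _]]; exact: IH.
Qed.

Lemma component_eq A u v : v \in component A u -> component A v = component A u.
Proof.
rewrite inE => uv; apply/setP => w; rewrite !inE.
by rewrite (same_connect (induced_sym A) uv).
Qed.

Lemma component_edge A u x y : u \in A -> x \in component A u -> y \in A -> e x y ->
  y \in component A u.
Proof.
move=> uA xu yA xy; have xA := subsetP (component_sub uA) _ xu.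
move: xu; rewrite !inE => /connect_trans; apply; apply: connect1.
by rewrite /induced /= xA yA.
Qed.

Lemma isolated_sub A : isolated_vertices A \subset A.
Proof. by apply/subsetP => u; rewrite inE => /andP[]. Qed.

Lemma isolatedP A u : reflect (u \in A /\ forall v, v \in A -> ~~ e u v) (u \in isolated_vertices A).
Proof.
rewrite inE; apply: (iffP andP) => [[uA /forall_inP H]|[uA H]]; split=> //.
exact/forall_inP.
Qed.

Lemma component_isolated A u : u \in isolated_vertices A -> component A u = [set u].
Proof.
move=> /isolatedP[uA uN]; apply/setP => v; rewrite !inE.
apply/idP/eqP => [/connectP[[|w p] //=]|->]; last exact: connect0.
by move=> /andP[/and3P[_ wA uw]]; have := uN _ wA; rewrite uw.
Qed.

Definition independent I : bool := [forall x in I, forall y in I, ~~ e x y].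

Lemma independentP I :
  reflect (forall x y, x \in I -> y \in I -> ~~ e x y) (independent I).
Proof.
apply: (iffP forall_inP) => [H x y xI yI|H x xI].
  by have /forall_inP := H x xI; apply.
by apply/forall_inP => y yI; exact: H.
Qed.

Lemma independent_isolated A : independent (isolated_vertices A).
Proof.
apply/independentP => x y /isolatedP[_ xN] /isolatedP[yA _]; exact: xN.
Qed.

Lemma independentS I D : D \subset I -> independent I -> independent D.
Proof.
by move=> /subsetP DI /independentP H; apply/independentP => x y /DI xI /DI; exact: H.
Qed.

Lemma independent_unlinked I D x : independent I -> D \subset I -> x \in I ->
  x \notin D -> unlinked D [set x].
Proof.
move=> /independentP H /subsetP DI xI xD; apply/unlinkedP => y z yD.
rewrite inE => /eqP ->; split; last by apply: H => //; exact: DI.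
by apply: contraNneq xD => <-.
Qed.

(** Other components are untouched by the deletion, and no vertex of the component of [u] was
    isolated in [A]; hence [u] is the only new isolated vertex. *)
Lemma isolated_resample A u : u \in A -> u \notin isolated_vertices A ->
  let A' := A :\: (component A u :\ u) in
  u \in isolated_vertices A' /\ isolated_vertices A' :\ u = isolated_vertices A.
Proof.
move=> uA uN A'.
have uA' : u \in A' by rewrite in_setD in_setD1 eqxx.
have inA' v : v \in A -> v \notin component A u -> v \in A'.
  by move=> vA vC; rewrite in_setD in_setD1 vA (negbTE vC) andbF.
have A'A v : v \in A' -> v \in A by rewrite in_setD => /andP[].
have A'C v : v \in A' -> v != u -> v \notin component A u.
  by rewrite in_setD in_setD1 => /andP[+ _] vu; rewrite vu.
have u' : u \in isolated_vertices A'.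
  apply/isolatedP; split=> // v vA'; apply/negP => uv.
  have vu : v != u by apply: contraTneq uv => ->; rewrite e_irr.
  have := A'C _ vA' vu; rewrite (@component_edge A u u v) //.
    exact: component_refl.
  exact: A'A.
split=> //; apply/setP => v; rewrite in_setD1; apply/andP/idP.
  move=> [vu /isolatedP[vA' vN]]; apply/isolatedP; split; first exact: A'A.
  move=> w wA; apply/negP => vw; have vC := A'C _ vA' vu.
  have wC : w \notin component A u.
    apply: contra vC => wC; apply: (component_edge uA wC); first exact: A'A.
    by rewrite e_sym.
  by have := vN _ (inA' _ wA wC); rewrite vw.
move=> vI; have vA := subsetP (isolated_sub A) _ vI.
have vu : v != u by apply: contraNneq uN => <-.
split=> //; have vC : v \notin component A u.
  apply: contra vu => vC; have := component_eq vC; rewrite component_isolated // => E.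
  by have := component_refl A u; rewrite -E inE eq_sym.
apply/isolatedP; split; first exact: inA'.
by move=> w /A'A; case/isolatedP: vI => _; apply.
Qed.

(** * Counting connected sets by walks *)

Section Counting.
Variable Delta : nat.
Hypothesis e_deg : forall x, (#|[set y | e x y]| <= Delta)%N.

Lemma card_walks_le n u : (#|[set w : n.-tuple V | path e u w]| <= Delta ^ n)%N.
Proof.
elim: n u => [|n IH] u.
  by rewrite expn0 (leq_trans (max_card _)) // card_tuple expn0.
have -> : [set w : n.+1.-tuple V | path e u w] =
    \bigcup_(x in [set y | e u y]) [set cons_tuple x w | w in [set w : n.-tuple V | path e x w]].
  apply/setP => w; rewrite inE; apply/idP/bigcupP.
    case/tupleP: w => x w /= /andP[ux xw]; exists x; first by rewrite inE.
    by apply/imsetP; exists w => //; rewrite inE.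
  move=> [x]; rewrite inE => ux /imsetP[w']; rewrite inE => xw' -> /=.
  by rewrite ux.
have cardU (I : finType) (P : pred I) (F : I -> {set n.+1.-tuple V}) :
    (#|\bigcup_(i | P i) F i| <= \sum_(i | P i) #|F i|)%N.
  elim/big_rec2: _ => [|i k B _ IHk]; first by rewrite cards0.
  by apply: leq_trans (leq_card_setU _ _).1 _; rewrite leq_add2l.
apply: (leq_trans (cardU _ _ _)).
apply: (@leq_trans (\sum_(x in [set y | e u y]) Delta ^ n)).
  by apply: leq_sum => x _; apply: leq_trans (leq_imset_card _ _) (IH x).
by rewrite sum_nat_const expnS leq_mul2r e_deg orbT.
Qed.

(** While the walk misses part of the component, some edge leads from a visited [x] to an unvisited
    [y]; a detour x, y, x costs two steps and adds one vertex. *)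
Lemma component_walk A u m : u \in A -> (m < #|component A u|)%N ->
  exists p, [/\ path e u p, size p = m.*2, {subset u :: p <= component A u} &
    #|[set x in u :: p]| = m.+1].
Proof.
move=> uA; elim: m => [|m IH] mC.
  exists [::]; split => //; first by move=> x; rewrite inE => /eqP ->; exact: component_refl.
  by rewrite -[RHS](cards1 u); apply: eq_card => x; rewrite !inE.
have [p [pP sp pC cp]] := IH (ltnW mC).
set X := [set x in u :: p] in cp.
have [x [y [xX yX yC xy]]] : exists x y, [/\ x \in X, y \notin X, y \in component A u & e x y].
  apply: contrapT => H.
  suff : component A u \subset X by move/subset_leq_card; rewrite cp leqNgt mC.
  apply/subsetP => v; rewrite inE => /connectP[q qP ->].
  have uX : u \in X by rewrite inE mem_head.
  have uC := component_refl A u.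
  suff W w r : w \in component A u -> w \in X -> path (induced A) w r -> last w r \in X.
    exact: W uC uX qP.
  elim: r w => //= w' r IHr w wC wX /andP[/and3P[_ wA ww] wr].
  have wC' := component_edge uA wC wA ww.
  apply: (IHr _ wC' _ wr); apply: contrapT => /negP wX'.
  by apply: H; exists w, w'.
have xp : x \in u :: p by rewrite inE in xX.
rewrite {}/X in cp xX yX.
case/splitPl: xp pP sp pC cp xX yX => p1 p2 lp1.
rewrite cat_path lp1 => /andP[p1P p2P] sp pC cp xX yX.
exists (p1 ++ [:: y, x & p2]); split.
- by rewrite cat_path p1P lp1 /= xy e_sym xy.
- by rewrite size_cat /= !addnS -size_cat sp doubleS.
- move=> z; rewrite in_cons mem_cat !in_cons => /or4P[|||/orP[]].
  + by move=> zu; apply: pC; rewrite inE zu.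
  + by move=> zp; apply: pC; rewrite inE mem_cat zp orbT.
  + by move=> /eqP ->.
  + by move=> /eqP ->; apply: pC; rewrite inE in xX.
  + by move=> zp; apply: pC; rewrite inE mem_cat zp !orbT.
- have -> : [set z in u :: p1 ++ [:: y, x & p2]] = y |: [set z in u :: p1 ++ p2].
    apply/setP => z; rewrite !inE !mem_cat !inE.
    have : x \in u :: p1 by rewrite -lp1 mem_last.
    rewrite inE => xu; case: (z =P x) => [->|_]; last by do !case: (_ \in _); do !case: (_ == _).
    by case/orP: xu => ->; rewrite ?orbT.
  by rewrite cardsU1 yX cp.
Qed.

(** Connectedness in the form in which it arises later: [A] is the component of [u] in some set. *)
Definition connected_at u A : bool :=
  [exists B : {set V}, (u \in B) && (component B u == A)].

(* A connected set with k + 1 elements is covered by a walk with 2 k steps. *)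
Lemma card_connected_at_le u k :
  (#|[set A | connected_at u A && (#|A| == k.+1)]| <= Delta ^ k.*2)%N.
Proof.
pose F (w : k.*2.-tuple V) := [set x in u :: w].
apply: leq_trans (card_walks_le k.*2 u).
apply: (@leq_trans #|F @: [set w : k.*2.-tuple V | path e u w]|); last exact: leq_imset_card.
apply/subset_leq_card/subsetP => A; rewrite inE => /andP[/existsP[B /andP[uB /eqP BA]] /eqP Ak].
have [|p [pP sp pC cp]] := @component_walk B u k uB; first by rewrite BA Ak.
have szp : size p == k.*2 by rewrite sp.
apply/imsetP; exists (Tuple szp); first by rewrite inE.
apply/esym/eqP; rewrite eqEcard /F /= cp Ak leqnn andbT.
by apply/subsetP => x; rewrite -BA; rewrite inE; exact: pC.
Qed.

Lemma sum_half_le n : \sum_(k < n) (if k == 0%N :> nat then 0 else (2^-1 : R) ^+ k) <= 1.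
Proof.
case: n => [|n]; first by rewrite big_ord0.
suff -> : \sum_(k < n.+1) (if k == 0%N :> nat then 0 else (2^-1 : R) ^+ k) = 1 - 2^-1 ^+ n.
  by rewrite lerBlDr lerDl exprn_ge0.
elim: n => [|n IH]; first by rewrite big_ord1 expr0 subrr.
by rewrite big_ord_recr /= IH exprS; lra.
Qed.

(** The sets with k + 1 elements contribute at most [(y * Delta%:R ^+ 2) ^+ k], a geometric series
    of ratio at most 1/2. Singletons are left out, since k = 0 would already contribute 1. *)
Lemma sum_connected_at_le u (y : R) : 0 <= y -> y * Delta%:R ^+ 2 <= 2^-1 ->
  \sum_(A : {set V} | connected_at u A && (1 < #|A|)%N) y ^+ (#|A|.-1) <= 1.
Proof.
move=> y0 yD.
rewrite (partition_big (fun A : {set V} => inord #|A|.-1 : 'I_#|V|.+1) xpredT) //=.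
apply: le_trans (sum_half_le #|V|.+1); apply: ler_sum => k _.
have cV (A : {set V}) : (#|A|.-1 < #|V|.+1)%N.
  by rewrite ltnS (leq_trans (leq_pred _)) // max_card.
case: eqP => [k0|/eqP k0].
  rewrite big1 // => A /andP[/andP[_ A1] /eqP Ak].
  by move: A1; have := congr1 val Ak; rewrite /= inordK // k0; case: #|A| => [|[|]].
apply: (@le_trans _ _ (\sum_(A in [set A | connected_at u A && (#|A| == k.+1)]) y ^+ k)).
  rewrite big_mkcond [leRHS]big_mkcond; apply: ler_sum => A _; rewrite inE.
  case: ifP => [/andP[/andP[uA A1] /eqP Ak]|_]; last by case: ifP => // _; rewrite exprn_ge0.
  have Ak' : #|A|.-1 = k by rewrite -Ak /= inordK.
  by rewrite uA -Ak' prednK ?eqxx // ltnW.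
rewrite sumr_const -[leLHS]mulr_natl.
apply: (@le_trans _ _ ((Delta ^ k.*2)%:R * y ^+ k)).
  by rewrite ler_wpM2r ?exprn_ge0 // ler_nat card_connected_at_le.
rewrite natrX -muln2 mulnC exprM -exprMn mulrC.
by apply: lerXn2r => //; rewrite nnegrE ?mulr_ge0 // exprn_ge0.
Qed.

End Counting.
End Components.

(** * Elementary inequalities for the logarithm *)

Section LogInequalities.
Context {R : realType}.
Implicit Types x y m : R.

Lemma ln_le_subr1 x : 0 < x -> ln x <= x - 1.
Proof.
move=> x0; have := @le_ln1Dx R (x - 1); rewrite subrKC; apply; lra.
Qed.

(** Pointwise form of the nonnegativity of relative entropy; the implication is absolute continuity
    and admits densities that vanish. *)
Lemma xlnx_div_ge_sub x y : 0 <= x -> 0 <= y -> (0 < x -> 0 < y) ->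
  x - y <= x * ln (x / y).
Proof.
rewrite le_eqVlt => /predU1P[<-|x0] y0 xy; first by rewrite mul0r; lra.
have {xy}y0 := xy x0.
have yx : 0 < y / x by rewrite divr_gt0.
have := ln_le_subr1 yx.
rewrite -(invf_div x y) lnV ?posrE ?divr_gt0 // invf_div => h.
have -> : x - y = x * (1 - y / x) by field; rewrite gt_eqF.
by rewrite ler_pM2l //; lra.
Qed.

(* From [ln u >= 2 (1 - 1 / sqrt u)] at [u = x / m]. *)
Lemma xlnx_div_ge_sqrt x m : 0 <= x -> 0 <= m -> (0 < x -> 0 < m) ->
  2 * x - 2 * (Num.sqrt x * Num.sqrt m) <= x * ln (x / m).
Proof.
rewrite le_eqVlt => /predU1P[<-|x0] m0 xm; first by rewrite sqrtr0 !mul0r; lra.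
have {xm}m0 := xm x0.
have sx : 0 < Num.sqrt x by rewrite sqrtr_gt0.
have sm : 0 < Num.sqrt m by rewrite sqrtr_gt0.
have xE : x = Num.sqrt x ^+ 2 by rewrite sqr_sqrtr ?ltW.
have mE : m = Num.sqrt m ^+ 2 by rewrite sqr_sqrtr ?ltW.
have -> : ln (x / m) = 2 * ln (Num.sqrt x / Num.sqrt m).
  by rewrite [in LHS]xE [in LHS]mE -expr_div_n lnXn ?divr_gt0 // mulr_natl.
have H := @xlnx_div_ge_sub (Num.sqrt x) (Num.sqrt m) (ltW sx) (ltW sm) (fun _ => sm).
rewrite {1 3}xE.
have -> : 2 * Num.sqrt x ^+ 2 - 2 * (Num.sqrt x * Num.sqrt m) =
  2 * Num.sqrt x * (Num.sqrt x - Num.sqrt m) by ring.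
have -> : Num.sqrt x ^+ 2 * (2 * ln (Num.sqrt x / Num.sqrt m)) =
  2 * Num.sqrt x * (Num.sqrt x * ln (Num.sqrt x / Num.sqrt m)) by ring.
by apply: ler_wpM2l => //; rewrite mulr_ge0 // ltW.
Qed.

(** Write x - 1 as the product of sqrt x - 1 and sqrt x + 1. The square of the first is at most x ln
    x - x + 1, that of the second at most 2 x + 2 <= 4 m. With m = 1 / b this is the source of 4 /
    b. *)
Lemma xlnx_ge_sqr x m : 0 <= x -> x <= m -> 1 <= m ->
  (x - 1) ^+ 2 <= 4 * m * (x * ln x - x + 1).
Proof.
move=> x0 xm m1.
have H : 2 * x - 2 * Num.sqrt x <= x * ln x.
  have := @xlnx_div_ge_sqrt x 1 x0 ler01 (fun _ => ltr01).
  by rewrite sqrtr1 mulr1 divr1.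
have s0 : 0 <= Num.sqrt x by rewrite sqrtr_ge0.
have sE : Num.sqrt x ^+ 2 = x by rewrite sqr_sqrtr.
have h1 : (x - 1) ^+ 2 = (Num.sqrt x - 1) ^+ 2 * (Num.sqrt x + 1) ^+ 2.
  by rewrite -{1}sE; ring.
have h2 : (Num.sqrt x + 1) ^+ 2 <= 4 * m.
  have := sqr_ge0 (Num.sqrt x - 1); rewrite !sqrrD sE; lra.
have h3 : (Num.sqrt x - 1) ^+ 2 <= x * ln x - x + 1.
  by rewrite sqrrD sE; lra.
rewrite h1 mulrC; apply: ler_pM => //; exact: sqr_ge0.
Qed.

End LogInequalities.

(** * Conditional expectation and entropy on a finite probability space *)

Section ConditionalExpectation.
Context {R : realType} {T : finType}.
Variable mu : T -> R.
Hypothesis mu_gt0 : forall s, 0 < mu s.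
Implicit Types (e : rel T) (f g : T -> R).

Definition cmass e s : R := \sum_(t | e s t) mu t.
(** The classes of [e] are the atoms of a sigma-algebra, and this is the conditional expectation
    given it; [subrel e e'] says that [e] is the finer one. *)
Definition cexp e f s : R := \sum_(t | e s t) mu t / cmass e s * f t.

Lemma cmass_gt0 e s : reflexive e -> 0 < cmass e s.
Proof.
move=> er; rewrite /cmass (bigD1 s) ?er //= ltr_wpDr //.
by apply: sumr_ge0 => t _; apply: ltW.
Qed.

Lemma cprob_ge0 e s t : 0 <= mu t / cmass e s.
Proof.
by apply: divr_ge0; [exact: ltW | apply: sumr_ge0 => u _; apply: ltW].
Qed.

Lemma cprob_sum e s : reflexive e -> \sum_(t | e s t) mu t / cmass e s = 1.
Proof. by move=> er; rewrite -mulr_suml divff // gt_eqF ?cmass_gt0. Qed.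

Lemma cexp_cst e c s : reflexive e -> cexp e (fun=> c) s = c.
Proof. by move=> er; rewrite /cexp -mulr_suml cprob_sum // mul1r. Qed.

Lemma cexpD e f g s : cexp e (fun t => f t + g t) s = cexp e f s + cexp e g s.
Proof. by rewrite /cexp -big_split; apply: eq_bigr => t _; rewrite mulrDr. Qed.

Lemma cexpZ e c f s : cexp e (fun t => c * f t) s = c * cexp e f s.
Proof. by rewrite /cexp mulr_sumr; apply: eq_bigr => t _; rewrite mulrCA. Qed.

Lemma cexpN e f s : cexp e (fun t => - f t) s = - cexp e f s.
Proof.
by rewrite -mulN1r -cexpZ; apply: eq_bigr => t _; rewrite mulN1r.
Qed.

Lemma cexpB e f g s : cexp e (fun t => f t - g t) s = cexp e f s - cexp e g s.
Proof. by rewrite cexpD cexpN. Qed.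

Lemma cexp_sum (I : Type) (r : seq I) (P : pred I) (F : I -> T -> R) e s :
  cexp e (fun t => \sum_(i <- r | P i) F i t) s =
  \sum_(i <- r | P i) cexp e (F i) s.
Proof.
rewrite /cexp exchange_big; apply: eq_bigr => t _.
by rewrite mulr_sumr.
Qed.

Lemma eq_cexp e f g s : (forall t, e s t -> f t = g t) -> cexp e f s = cexp e g s.
Proof. by move=> fg; apply: eq_bigr => t /fg ->. Qed.

Lemma le_cexp e f g s :
  (forall t, e s t -> f t <= g t) -> cexp e f s <= cexp e g s.
Proof.
move=> fg; apply: ler_sum => t /fg; apply: ler_wpM2l; exact: cprob_ge0.
Qed.

Lemma cexp_ge0 e f s : (forall t, e s t -> 0 <= f t) -> 0 <= cexp e f s.
Proof. by move=> f0; apply: sumr_ge0 => t /f0; apply: mulr_ge0 (cprob_ge0 _ _ _). Qed.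

Lemma cexp_ge_term e f s t : (forall u, e s u -> 0 <= f u) -> e s t ->
  mu t / cmass e s * f t <= cexp e f s.
Proof.
move=> f0 est; rewrite /cexp (bigD1 t) //= lerDl.
apply: sumr_ge0 => u /andP[/f0 fu _].
by apply: mulr_ge0 (cprob_ge0 _ _ _) fu.
Qed.

Lemma cexp_gt0 e f s : reflexive e -> (forall t, 0 <= f t) -> 0 < f s ->
  0 < cexp e f s.
Proof.
move=> er f0 fs; apply: lt_le_trans (@cexp_ge_term e f s s _ (er s)) => //.
by rewrite mulr_gt0 // divr_gt0 // cmass_gt0.
Qed.

Lemma cexp_eq0 e f s : reflexive e -> (forall t, 0 <= f t) ->
  cexp e f s = 0 -> f s = 0.
Proof.
move=> er f0 E0; apply/eqP; rewrite eq_le f0 andbT leNgt; apply/negP => fs.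
by have := cexp_gt0 er f0 fs; rewrite E0 ltxx.
Qed.

Lemma cmass_class e s t : equivalence_rel e -> e s t -> cmass e s = cmass e t.
Proof.
move=> /equivalence_relP[er et] est; rewrite /cmass.
by apply: eq_bigl => u; rewrite (et _ _ est).
Qed.

Lemma cexp_class e f s t : equivalence_rel e -> e s t -> cexp e f s = cexp e f t.
Proof.
move=> ee est; rewrite /cexp (cmass_class ee est).
by have /equivalence_relP[er et] := ee; apply: eq_bigl => u; rewrite (et _ _ est).
Qed.

Lemma cexp_mull e f g s : (forall t, e s t -> g t = g s) ->
  cexp e (fun t => g t * f t) s = g s * cexp e f s.
Proof. by move=> gs; rewrite -cexpZ; apply: eq_cexp => t /gs ->. Qed.

Lemma cexp_id e f s : reflexive e -> (forall t, e s t -> f t = f s) ->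
  cexp e f s = f s.
Proof.
move=> er fs; rewrite -(cexp_cst (f s) s er).
exact: eq_cexp.
Qed.

Lemma cexp_tower e e' f s : equivalence_rel e -> equivalence_rel e' ->
  subrel e e' -> cexp e' (cexp e f) s = cexp e' f s.
Proof.
move=> ee ee' sub; have /equivalence_relP[er et] := ee.
have /equivalence_relP[er' et'] := ee'.
rewrite /cexp; under eq_bigr => t est do rewrite mulr_sumr.
rewrite (exchange_big_dep (e' s)) /=; last first.
  by move=> t u est /sub etu; rewrite (et' _ _ est).
apply: eq_bigr => u esu.
transitivity (\sum_(t | e u t) mu t / cmass e u * (mu u / cmass e' s * f u)).
  apply: eq_big => [t|t /andP[_ etu]]; last by rewrite (cmass_class ee etu); ring.
  have -> : e u t = e t u.
    by apply/idP/idP => H; [rewrite -(et _ _ H) | rewrite -(et _ _ H)]; rewrite er.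
  apply/andP/idP => [[]//|etu]; split => //.
  by have /sub etu' := etu; rewrite (et' _ _ esu) -(et' _ _ etu') er'.
by rewrite -mulr_suml cprob_sum // mul1r.
Qed.

(** Log-sum inequality: for c the ratio of the two expectations, f ln (f / g) >= f ln c + (f - c g)
    pointwise, and the bracket has conditional mean 0. *)
Lemma cexp_log_sum e f g s : reflexive e ->
  (forall t, 0 <= f t) -> (forall t, 0 <= g t) -> (forall t, 0 < f t -> 0 < g t) ->
  cexp e f s * ln (cexp e f s / cexp e g s) <=
  cexp e (fun t => f t * ln (f t / g t)) s.
Proof.
move=> er f0 g0 fg.
have [Ef0|Efn0] := eqVneq (cexp e f s) 0.
  rewrite Ef0 mul0r; apply: sumr_ge0 => t est.
  suff -> : f t = 0 by rewrite mul0r mulr0.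
  have := @cexp_ge_term e f s t (fun u _ => f0 u) est; rewrite Ef0 => h.
  apply/eqP; rewrite eq_le f0 andbT leNgt; apply/negP => ft.
  have : 0 < mu t / cmass e s * f t by rewrite mulr_gt0 // divr_gt0 // cmass_gt0.
  by rewrite ltNge h.
have Ef : 0 < cexp e f s by rewrite lt_neqAle eq_sym Efn0 cexp_ge0.
have Eg : 0 < cexp e g s.
  rewrite lt_neqAle eq_sym cexp_ge0 // andbT; apply: contra_neq Efn0 => Eg0.
  apply: big1 => t est; suff -> : f t = 0 by rewrite mulr0.
  have := @cexp_ge_term e g s t (fun u _ => g0 u) est; rewrite Eg0 => h.
  apply/eqP; rewrite eq_le f0 andbT leNgt; apply/negP => /fg gt.
  have : 0 < mu t / cmass e s * g t by rewrite mulr_gt0 // divr_gt0 // cmass_gt0.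
  by rewrite ltNge h.
set c := cexp e f s / cexp e g s.
have c0 : 0 < c by rewrite divr_gt0.
have cE : c * cexp e g s = cexp e f s by rewrite /c divfK // gt_eqF.
clearbody c.
have h t : f t * ln c + (f t - c * g t) <= f t * ln (f t / g t).
  have [ft0|ftn0] := eqVneq (f t) 0.
    by rewrite ft0 !mul0r !add0r oppr_le0 mulr_ge0 // ltW.
  have ft : 0 < f t by rewrite lt_neqAle eq_sym ftn0 f0.
  have gt := fg _ ft.
  have -> : f t * ln (f t / g t) = f t * ln c + f t * ln (f t / (c * g t)).
    rewrite -mulrDr -lnM ?posrE //; last by rewrite divr_gt0 // mulr_gt0.
    by do 2 congr (_ _); field; rewrite !gt_eqF.
  rewrite lerD2l; apply: xlnx_div_ge_sub => //; rewrite ?mulr_ge0 // ?ltW //.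
  by move=> _; rewrite mulr_gt0.
apply: le_trans (le_cexp (fun t _ => h t)).
rewrite cexpD cexpB cexpZ.
rewrite (_ : cexp e (fun t => f t * ln c) s = ln c * cexp e f s); last first.
  by rewrite -cexpZ; apply: eq_cexp => t _; rewrite mulrC.
by rewrite cE subrr addr0 mulrC.
Qed.

End ConditionalExpectation.

Section ConditionalEntropy.
Context {R : realType} {T : finType}.
Variable mu : T -> R.
Hypothesis mu_gt0 : forall s, 0 < mu s.
Implicit Types (e : rel T) (f g : T -> R).

Definition expect f : R := \sum_s mu s * f s.

Definition cent e f : R := expect (fun s => f s * ln (f s / cexp mu e f s)).

Lemma eq_expect f g : f =1 g -> expect f = expect g.
Proof. by move=> fg; apply: eq_bigr => s _; rewrite fg. Qed.

Lemma expectD f g : expect (fun s => f s + g s) = expect f + expect g.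
Proof. by rewrite /expect -big_split; apply: eq_bigr => s _; rewrite mulrDr. Qed.

Lemma expectZ c f : expect (fun s => c * f s) = c * expect f.
Proof. by rewrite /expect mulr_sumr; apply: eq_bigr => s _; rewrite mulrCA. Qed.

Lemma expectN f : expect (fun s => - f s) = - expect f.
Proof. by rewrite /expect -sumrN; apply: eq_bigr => s _; rewrite mulrN. Qed.

Lemma expectB f g : expect (fun s => f s - g s) = expect f - expect g.
Proof. by rewrite expectD expectN. Qed.

Lemma expect_sum (I : Type) (r : seq I) (P : pred I) (F : I -> T -> R) :
  expect (fun s => \sum_(i <- r | P i) F i s) =
  \sum_(i <- r | P i) expect (F i).
Proof.
by rewrite /expect exchange_big; apply: eq_bigr => s _; rewrite mulr_sumr.
Qed.

Lemma le_expect f g : (forall s, f s <= g s) -> expect f <= expect g.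
Proof. by move=> fg; apply: ler_sum => s _; apply: ler_wpM2l => //; apply: ltW. Qed.

Lemma expect_cexp e f : equivalence_rel e -> expect (cexp mu e f) = expect f.
Proof.
move=> ee; have eT : equivalence_rel (fun _ _ : T => true) by [].
rewrite /expect.
have H g : \sum_s mu s * g s =
    (\sum_s mu s) * \sum_(s | true) mu s / cmass mu (fun _ _ => true) s * g s.
  rewrite mulr_sumr; apply: eq_bigr => s _; rewrite mulrA; congr (_ * _).
  rewrite mulrC divfK // gt_eqF //; exact: cmass_gt0.
case: (pickP T) => [s0 _|T0]; last first.
  by rewrite big1; [rewrite big1 // => s | move=> s]; have := T0 s.
by rewrite !H; congr (_ * _); exact: (@cexp_tower _ _ _ mu_gt0 e _ f s0 ee eT).
Qed.

Lemma cent_ge0 e f : equivalence_rel e -> (forall s, 0 <= f s) -> 0 <= cent e f.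
Proof.
move=> ee f0; have er : reflexive e by have [] := (equivalence_relP e).1 ee.
rewrite -[leLHS](subrr (expect f)) -{2}(expect_cexp f ee) -expectB.
apply: le_expect => s; apply: xlnx_div_ge_sub => //.
  exact: cexp_ge0.
exact: cexp_gt0.
Qed.

(** Chain rule: the logarithms of [f] cancel, and the remaining one is constant on the classes of
    [e], so [f] may be replaced by its conditional expectation. *)
Lemma cent_chain e e' f : equivalence_rel e -> equivalence_rel e' -> subrel e e' ->
  (forall s, 0 <= f s) ->
  cent e' f - cent e f = cent e' (cexp mu e f).
Proof.
move=> ee ee' sub f0; have er : reflexive e by have [] := (equivalence_relP e).1 ee.
have er' : reflexive e' by have [] := (equivalence_relP e').1 ee'.
rewrite /cent -expectB.
transitivity (expect (fun s => ln (cexp mu e f s / cexp mu e' f s) * f s)).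
  apply: eq_expect => s.
  have [fs0|fsn0] := eqVneq (f s) 0; first by rewrite fs0 !mul0r mulr0 subrr.
  have fs : 0 < f s by rewrite lt_neqAle eq_sym fsn0 f0.
  have Es := cexp_gt0 mu_gt0 er f0 fs; have Es' := cexp_gt0 mu_gt0 er' f0 fs.
  by rewrite !ln_div ?posrE //; ring.
rewrite -(expect_cexp _ ee); apply: eq_expect => s.
rewrite (@cexp_mull _ _ mu e f (fun t => ln (cexp mu e f t / cexp mu e' f t)) s).
  by rewrite mulrC cexp_tower.
by move=> t est; rewrite -(cexp_class mu f ee est) -(cexp_class mu f ee' (sub _ _ est)).
Qed.

Lemma le_cent e e' f : equivalence_rel e -> equivalence_rel e' -> subrel e e' ->
  (forall s, 0 <= f s) -> cent e f <= cent e' f.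
Proof.
move=> ee ee' sub f0; rewrite -subr_ge0 cent_chain //.
by apply: cent_ge0 => // s; apply: cexp_ge0.
Qed.

(** By commutation, both [cexp mu e f] and its [e']-expectation are averages over the classes of
    [e]; the log-sum inequality applies in each class. *)
Lemma cent_cexp_le e e' f : equivalence_rel e -> equivalence_rel e' ->
  (forall s, cexp mu e' (cexp mu e f) s = cexp mu e (cexp mu e' f) s) ->
  (forall s, 0 <= f s) ->
  cent e' (cexp mu e f) <= cent e' f.
Proof.
move=> ee ee' comm f0; have er : reflexive e by have [] := (equivalence_relP e).1 ee.
have er' : reflexive e' by have [] := (equivalence_relP e').1 ee'.
rewrite /cent -[leRHS](expect_cexp _ ee); apply: le_expect => s.
rewrite comm; apply: cexp_log_sum => // [t|t].
  exact: cexp_ge0.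
exact: cexp_gt0.
Qed.

(* With x = E_e f and y = E_eu f * E_ev f / E_eS f, the left-hand side is the
   mean of - x ln (x / y), which is at most that of y - x. Where E_eS f = 0 the
   quotients are 0 by convention, and x and y vanish as well. *)
Lemma cent_second_diff_le e eu ev eS f :
  equivalence_rel e -> equivalence_rel eu -> equivalence_rel ev ->
  equivalence_rel eS -> subrel e eu -> subrel e ev -> subrel eu eS ->
  subrel ev eS -> (forall s, 0 <= f s) ->
  cent eS f - cent eu f - cent ev f + cent e f <=
  expect (fun s => cexp mu eS f s *
    ((cexp mu eu f s / cexp mu eS f s - 1) *
     (cexp mu ev f s / cexp mu eS f s - 1))).
Proof.
move=> ee eeu eev eeS su sv suS svS f0.
have er : reflexive e by have [] := (equivalence_relP e).1 ee.
have eru : reflexive eu by have [] := (equivalence_relP eu).1 eeu.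
have erv : reflexive ev by have [] := (equivalence_relP ev).1 eev.
have erS : reflexive eS by have [] := (equivalence_relP eS).1 eeS.
set g := cexp mu eS f; set gu := cexp mu eu f; set gv := cexp mu ev f; set ge := cexp mu e f.
have gu0 s : 0 <= gu s by apply: cexp_ge0.
have gv0 s : 0 <= gv s by apply: cexp_ge0.
have g0 s : 0 <= g s by apply: cexp_ge0.
have ge0 s : 0 <= ge s by apply: cexp_ge0.
have guE s : g s = 0 -> gu s = 0.
  rewrite /g -(cexp_tower mu_gt0 f s eeu eeS suS).
  by move/(@cexp_eq0 _ _ mu mu_gt0 eS); apply.
have gvE s : g s = 0 -> gv s = 0.
  rewrite /g -(cexp_tower mu_gt0 f s eev eeS svS).
  by move/(@cexp_eq0 _ _ mu mu_gt0 eS); apply.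
have geuE s : gu s = 0 -> ge s = 0.
  rewrite /gu -(cexp_tower mu_gt0 f s ee eeu su).
  by move/(@cexp_eq0 _ _ mu mu_gt0 eu); apply.
have gevE s : gv s = 0 -> ge s = 0.
  rewrite /gv -(cexp_tower mu_gt0 f s ee eev sv).
  by move/(@cexp_eq0 _ _ mu mu_gt0 ev); apply.
have pos (k : T -> R) s : (forall s, 0 <= k s) -> k s != 0 -> 0 < k s.
  by move=> k0 kn; rewrite lt_neqAle eq_sym kn k0.
have -> : cent eS f - cent eu f - cent ev f + cent e f =
    - expect (fun s => ge s * ln (ge s / (gu s * gv s / g s))).
  rewrite /cent -!expectB -expectD -expectN.
  transitivity (expect (fun s => - (ln (ge s / (gu s * gv s / g s)) * f s))).
    apply: eq_expect => s.
    have [fs0|fsn0] := eqVneq (f s) 0; first by rewrite fs0 !mul0r mulr0; ring.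
    have fs : 0 < f s by rewrite pos.
    have := cexp_gt0 mu_gt0 er f0 fs; have := cexp_gt0 mu_gt0 erS f0 fs.
    have := cexp_gt0 mu_gt0 eru f0 fs; have := cexp_gt0 mu_gt0 erv f0 fs.
    rewrite -/(g s) -/(gu s) -/(gv s) -/(ge s) => a1 a2 a3 a4.
    by rewrite !ln_div ?lnM ?posrE ?divr_gt0 ?mulr_gt0 //; ring.
  rewrite !expectN; congr (- _); rewrite -(expect_cexp _ ee).
  apply: eq_expect => s.
  rewrite (@cexp_mull _ _ mu e f (fun s => ln (ge s / (gu s * gv s / g s))) s).
    by rewrite mulrC.
  move=> t est; rewrite /ge /gu /gv /g.
  by rewrite -(cexp_class mu f ee est) -(cexp_class mu f eeu (su _ _ est))
    -(cexp_class mu f eev (sv _ _ est)) -(cexp_class mu f eeS (suS _ _ (su _ _ est))).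
(* The product expands to gu gv / g - gu - gv + g, and [gu], [gv], [g], [ge] all have the mean of
   [f]. *)
have -> : expect (fun s => g s * ((gu s / g s - 1) * (gv s / g s - 1))) =
    expect (fun s => gu s * gv s / g s - ge s).
  have e1 : expect gu = expect f by apply: expect_cexp.
  have e2 : expect gv = expect f by apply: expect_cexp.
  have e3 : expect g = expect f by apply: expect_cexp.
  have e4 : expect ge = expect f by apply: expect_cexp.
  transitivity (expect (fun s => gu s * gv s / g s - gu s - gv s + g s)).
    apply: eq_expect => s; have [gs0|gsn0] := eqVneq (g s) 0.
      by rewrite gs0 (guE _ gs0) (gvE _ gs0); ring.
    by field.
  by rewrite expectD !expectB e1 e2 e3 e4; ring.
rewrite -expectN; apply: le_expect => s.
rewrite lerNl opprB; apply: xlnx_div_ge_sub => //.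
  by rewrite divr_ge0 ?mulr_ge0.
move=> ges; rewrite divr_gt0 ?mulr_gt0 // ?pos //.
- by apply: contraTneq ges => /geuE ->; rewrite ltxx.
- by apply: contraTneq ges => /gevE ->; rewrite ltxx.
- by apply: contraTneq ges => /guE /geuE ->; rewrite ltxx.
Qed.

(** This is [xlnx_ge_sqr] for the ratio x of the two conditional expectations, which is at most [M];
    weighted by the coarse one, the terms - x + 1 have mean 0. *)
Lemma cond_variance_le_entropy ev eS f (M : R) :
  equivalence_rel ev -> equivalence_rel eS -> subrel ev eS ->
  (forall s, 0 <= f s) -> 1 <= M ->
  (forall s, cexp mu ev f s <= M * cexp mu eS f s) ->
  expect (fun s => cexp mu eS f s *
    (cexp mu ev f s / cexp mu eS f s - 1) ^+ 2) <=
  4 * M * (cent eS f - cent ev f).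
Proof.
move=> eev eeS sv f0 M1; set g := cexp mu eS f => gvM.
have erS : reflexive eS by have [] := (equivalence_relP eS).1 eeS.
rewrite cent_chain //; set gv := cexp mu ev f.
have gv0 s : 0 <= gv s by apply: cexp_ge0.
have g0 s : 0 <= g s by apply: cexp_ge0.
have e2 : expect gv = expect f by apply: expect_cexp.
have e3 : expect g = expect f by apply: expect_cexp.
have -> : cent eS gv = expect (fun s => gv s * ln (gv s / g s) - gv s + g s).
  rewrite expectD expectB e2 e3 subrK; apply: eq_expect => s.
  by rewrite cexp_tower.
rewrite -expectZ; apply: le_expect => s.
have [gs0|gsn0] := eqVneq (g s) 0.
  have -> : gv s = 0.
    move: gs0; rewrite /g -(cexp_tower mu_gt0 f s eev eeS sv).
    by move/(@cexp_eq0 _ _ mu mu_gt0 eS); apply.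
  by rewrite gs0 !mul0r; lra.
have gs : 0 < g s by rewrite lt_neqAle eq_sym gsn0 g0.
have -> : gv s * ln (gv s / g s) - gv s + g s =
   g s * (gv s / g s * ln (gv s / g s) - gv s / g s + 1) by field.
rewrite [leRHS]mulrCA ler_pM2l //; apply: xlnx_ge_sqr => //.
  exact: divr_ge0.
by rewrite ler_pdivrMr.
Qed.

End ConditionalEntropy.

(** * Block entropies of a spin system *)

Section Gibbs.
Context {R : realType} {q : nat} {V W : finType}.
Variable S : spin_system R q V W.
Implicit Types (D A : {set V}) (s t u : Omega S) (f g : Omega S -> R).
Local Notation mu := (mu (S := S)).

Lemma partition_function_gt0 s : 0 < partition_function S.
Proof.
rewrite /partition_function (bigD1 s) //=; apply: ltr_wpDr; last exact: (valP s).
by apply: sumr_ge0 => t _; exact: (ltW (valP t)).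
Qed.

Lemma mu_gt0 s : 0 < mu s.
Proof. by rewrite /Defs.mu divr_gt0 ?(valP s) // (partition_function_gt0 s). Qed.

Lemma mu_sum s : \sum_(t : Omega S) mu t = 1.
Proof. by rewrite -mulr_suml divff // gt_eqF // (partition_function_gt0 s). Qed.

Lemma agree_offP D s t :
  reflect (forall x, x \notin D -> val s x = val t x) (agree_off D s t).
Proof.
apply: (iffP forallP) => H x; last by apply/implyP => /H ->.
by have /implyP h := H x; move=> /h /eqP.
Qed.

Lemma agree_off_equiv D : equivalence_rel (@agree_off _ _ _ _ S D).
Proof.
apply/equivalence_relP; split=> [s|s t /agree_offP st u].
  exact/agree_offP.
by apply/agree_offP/agree_offP => H x xD; [rewrite -st | rewrite st] => //; exact: H.
Qed.

Lemma agree_off_refl D : reflexive (@agree_off _ _ _ _ S D).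
Proof. by move=> s; apply/agree_offP. Qed.

Lemma agree_off_sym D : symmetric (@agree_off _ _ _ _ S D).
Proof.
by move=> s t; apply/agree_offP/agree_offP => H x xD; rewrite H.
Qed.

Lemma agree_off_sub D A : D \subset A ->
  subrel (@agree_off _ _ _ _ S D) (agree_off A).
Proof.
move=> /subsetP DA s t /agree_offP H; apply/agree_offP => x xA.
by apply: H; apply: contra xA; apply: DA.
Qed.

Lemma agree_off0 s t : agree_off set0 s t = (s == t).
Proof.
apply/agree_offP/eqP => [H|-> //]; apply/val_inj/ffunP => x.
by apply: H; rewrite inE.
Qed.

Lemma agree_offT s t : agree_off setT s t.
Proof. by apply/agree_offP => x; rewrite inE. Qed.

Lemma mean_blockE D f s : mean_block D f s = cexp mu (agree_off D) f s.
Proof.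
rewrite /mean_block /cexp [RHS]big_mkcond; apply: eq_bigr => t _.
by rewrite /mu_block; case: ifP => _; rewrite ?mul0r.
Qed.

Lemma mean_blockF D f : mean_block D f = cexp mu (agree_off D) f.
Proof. by apply/funext => s; exact: mean_blockE. Qed.

Lemma mean_Ent_blockE D f : mean_Ent_block D f = cent mu (agree_off D) f.
Proof. by apply: eq_bigr => s _; rewrite mean_blockE. Qed.

Lemma mean_block_setT f s : mean_block setT f s = mean f.
Proof.
rewrite mean_blockE; apply: eq_big => [t|t _]; first by rewrite agree_offT.
rewrite /cmass (eq_bigl xpredT) => [|u]; last by rewrite agree_offT.
by rewrite (mu_sum s) divr1.
Qed.

Lemma mean_Ent_block_setT f : mean_Ent_block setT f = Ent f.
Proof. by apply: eq_bigr => s _; rewrite mean_block_setT. Qed.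

Lemma mean_block_set0 f s : mean_block set0 f s = f s.
Proof.
rewrite mean_blockE cexp_id //; [exact: mu_gt0 | exact: agree_off_refl |].
by move=> t; rewrite agree_off0 => /eqP ->.
Qed.

Lemma mean_Ent_block_ge0 D f : (forall s, 0 <= f s) -> 0 <= mean_Ent_block D f.
Proof.
rewrite mean_Ent_blockE; apply: cent_ge0; [exact: mu_gt0 | exact: agree_off_equiv].
Qed.

Lemma mean_Ent_block_set0 f : (forall s, 0 <= f s) -> mean_Ent_block set0 f = 0.
Proof.
move=> f0; apply: big1 => s _; rewrite mean_block_set0.
have [->|fs] := eqVneq (f s) 0; first by rewrite mul0r mulr0.
by rewrite divff // ln1 !mulr0.
Qed.

Lemma mean_block_ge0 D f s : (forall s, 0 <= f s) -> 0 <= mean_block D f s.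
Proof.
by move=> f0; rewrite mean_blockE; apply: cexp_ge0 => //; exact: mu_gt0.
Qed.

Lemma mean_Ent_block_le D A f : D \subset A -> (forall s, 0 <= f s) ->
  mean_Ent_block D f <= mean_Ent_block A f.
Proof.
move=> DA f0; rewrite !mean_Ent_blockE; apply: le_cent => //.
- exact: mu_gt0.
- exact: agree_off_equiv.
- exact: agree_off_equiv.
- exact: agree_off_sub.
Qed.

Lemma mean_Ent_block_chain D A f : D \subset A -> (forall s, 0 <= f s) ->
  mean_Ent_block A f - mean_Ent_block D f = mean_Ent_block A (mean_block D f).
Proof.
move=> DA f0; rewrite !mean_Ent_blockE mean_blockF cent_chain //.
- exact: mu_gt0.
- exact: agree_off_equiv.
- exact: agree_off_equiv.
- exact: agree_off_sub.
Qed.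

Definition interior_adj : rel V := fun x y => adj S (inl x) (inl y).

Lemma interior_adj_sym : symmetric interior_adj.
Proof. by move=> x y; exact: adj_sym. Qed.

Lemma interior_adj_irr : irreflexive interior_adj.
Proof. by move=> x; exact: adj_irrefl. Qed.

Local Notation nonadjacent := (unlinked interior_adj).

Definition mix D (c d : @config q V) : @config q V :=
  [ffun x => if x \in D then d x else c x].

(** Cut and paste: an edge inside [D] has both ends exchanged, an edge outside [D] none. An edge
    leaving [D] ends outside [A], where [c] and [d] agree, so exchanging is harmless there too. *)
Lemma weight_mix D A (c d : @config q V) : nonadjacent D A ->
  (forall x, x \notin D :|: A -> c x = d x) ->
  weight S (mix D c d) * weight S (mix D d c) = weight S c * weight S d.
Proof.
move=> /unlinkedP na cd.
have H x y : adj S (inl x) (inl y) -> forall F : 'I_q -> 'I_q -> R,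
  F (mix D c d x) (mix D c d y) * F (mix D d c x) (mix D d c y) =
  F (c x) (c y) * F (d x) (d y).
  move=> xy F; rewrite !ffunE.
  have cx z : (z \in D) = false -> (z \in A) = false -> c z = d z.
    by move=> zD zA; apply: cd; rewrite inE zD zA.
  case xD : (x \in D); case yD : (y \in D) => //; try exact: mulrC.
    case yA : (y \in A); last by rewrite (cx y) // mulrC.
    by have [] := na _ _ xD yA; rewrite /interior_adj xy.
  case xA : (x \in A); last by rewrite (cx x) // mulrC.
  by have [] := na _ _ yD xA; rewrite /interior_adj adj_sym xy.
rewrite /weight.
have e (a1 a2 a3 b1 b2 b3 : R) : a1 * a2 * a3 * (b1 * b2 * b3) =
   (a1 * b1) * (a2 * b2) * (a3 * b3) by ring.
rewrite !e -!big_split; congr (_ * _ * _).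
- by apply: eq_bigr => -[x y] /andP[/= xy _]; exact: (H x y xy (interaction _ _ _)).
- apply: eq_bigr => -[x y] /= xy; rewrite !ffunE.
  by case: ifP => _ //; rewrite mulrC.
- by apply: eq_bigr => x _ /=; rewrite !ffunE; case: ifP => _ //; rewrite mulrC.
Qed.

(** The default [s] does not intervene in the uses below: by [weight_mix] the pasted configuration
    has positive weight. *)
Definition mixO D s t : Omega S := insubd s (mix D (val s) (val t)).

Lemma weight_ge0 (c : @config q V) : 0 <= weight S c.
Proof.
rewrite /weight; apply: mulr_ge0; first apply: mulr_ge0; apply: prodr_ge0.
- by move=> [x y] /andP[/= xy _]; exact: interaction_ge0.
- by move=> [x y] /= xy; exact: interaction_ge0.
- by move=> x _; exact: vertex_weight_ge0.
Qed.

Lemma val_mixO D A s t : nonadjacent D A -> agree_off (D :|: A) s t ->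
  val (mixO D s t) = mix D (val s) (val t).
Proof.
move=> na /agree_offP st; rewrite /mixO val_insubd ifT //.
have := weight_mix na st; rewrite lt_neqAle weight_ge0 andbT => h.
apply/eqP => w0; move: h; rewrite -w0 mul0r => /esym/eqP.
by rewrite gt_eqF // mulr_gt0 // (valP s, valP t).
Qed.

Lemma mu_mixO D A s t : nonadjacent D A -> agree_off (D :|: A) s t ->
  mu (mixO D s t) * mu (mixO D t s) = mu s * mu t.
Proof.
move=> na st; rewrite /Defs.mu mulrACA (val_mixO na) // (val_mixO na) 1?agree_off_sym //.
by rewrite (weight_mix na) 1?mulrACA //; exact/agree_offP.
Qed.

Lemma mixO_sym D A s t : nonadjacent D A -> agree_off (D :|: A) s t ->
  mixO D s t = mixO A t s.
Proof.
move=> na st; apply/val_inj; rewrite (val_mixO na) //.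
rewrite (@val_mixO A D) 1?(unlinkedC interior_adj_sym) //; last by rewrite setUC agree_off_sym.
apply/ffunP => x; rewrite !ffunE; have := (agree_offP _ _ _ st) x; rewrite !inE.
have [xD|xD] := boolP (x \in D); have [xA|xA] := boolP (x \in A) => //= H; last exact: H.
by have /unlinkedP/(_ x x xD xA)[] := na; rewrite eqxx.
Qed.

Lemma mixO_agree D A s t : nonadjacent D A -> agree_off (D :|: A) s t ->
  agree_off D s (mixO D s t).
Proof.
move=> na st; apply/agree_offP => x xD; rewrite (val_mixO na) // ffunE.
by rewrite (negbTE xD).
Qed.

Lemma mixO_agree' D A s t : nonadjacent D A -> agree_off (D :|: A) s t ->
  agree_off A (mixO D s t) t.
Proof.
move=> na st; rewrite (mixO_sym na) // agree_off_sym; apply: (@mixO_agree A D).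
  by rewrite (unlinkedC interior_adj_sym).
by rewrite setUC agree_off_sym.
Qed.

Lemma mixO_uniq D A s t u : nonadjacent D A ->
  agree_off D s u -> agree_off A u t -> u = mixO D s t.
Proof.
move=> na /agree_offP su /agree_offP ut; apply/val_inj.
rewrite (val_mixO na) //.
  apply/ffunP => x; rewrite ffunE; case: ifP => [xD|/negbT xD]; last by rewrite -su.
  apply: ut; apply/negP => xA.
  by have /unlinkedP/(_ x x xD xA)[] := na; rewrite eqxx.
apply/agree_offP => x; rewrite !inE negb_or => /andP[xD xA].
by rewrite su // ut.
Qed.

Lemma agree_off_comp D A s t u :
  agree_off D s u -> agree_off A u t -> agree_off (D :|: A) s t.
Proof.
move=> /agree_offP su /agree_offP ut; apply/agree_offP => x.
by rewrite inE negb_or => /andP[xD xA]; rewrite su // ut.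
Qed.

(** Conditional independence: the conditional probability of [u] on [D :|: A] is the product of
    those on [D] and on [A]. Pasting gives a bijection from the class of [u] for [D :|: A] to pairs
    from its two smaller classes. *)
Lemma cmass_mix D A u : nonadjacent D A ->
  mu u * cmass mu (agree_off (D :|: A)) u =
  cmass mu (agree_off D) u * cmass mu (agree_off A) u.
Proof.
move=> na; have na' : nonadjacent A D by rewrite (unlinkedC interior_adj_sym).
rewrite /cmass mulr_sumr big_distrlr /=.
rewrite (pair_big (fun x => agree_off D u x) (fun y => agree_off A u y)
  (fun x y => mu x * mu y)) /=.
rewrite (reindex_onto (fun z => (mixO D u z, mixO D z u))
  (fun p => mixO D p.2 p.1)) /=; last first.
  case=> x y /= /andP[ux uy].
  have yx : agree_off A y u by rewrite agree_off_sym.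
  have xu : agree_off D x u by rewrite agree_off_sym.
  have e1 : agree_off (D :|: A) y x.
    by rewrite setUC; exact: agree_off_comp yx ux.
  congr (_, _); apply/esym/(mixO_uniq na) => //.
    by rewrite agree_off_sym (mixO_agree' na).
  by rewrite agree_off_sym (mixO_agree na).
apply: eq_big => [z|z uz]; last by rewrite (mu_mixO na).
apply/idP/andP => [uz|[/andP[]]].
  have zu : agree_off (D :|: A) z u by rewrite agree_off_sym.
  split.
    by rewrite (mixO_agree na) //= agree_off_sym (mixO_agree' na).
  apply/eqP/esym/(mixO_uniq na); rewrite agree_off_sym.
    by rewrite (mixO_agree na).
  by rewrite (mixO_agree' na).
generalize (mixO D u z) (mixO D z u) => x y ux uy /eqP <-.
rewrite setUC; apply: (agree_off_comp uy); apply: (mixO_agree na).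
by rewrite setUC; apply: agree_off_comp ux; rewrite agree_off_sym.
Qed.

Lemma mean_block_setU D A f s : nonadjacent D A ->
  mean_block D (mean_block A f) s = mean_block (D :|: A) f s.
Proof.
move=> na; rewrite !mean_blockE /cexp.
under eq_bigr => u su do rewrite mean_blockE /cexp mulr_sumr.
rewrite (exchange_big_dep (agree_off (D :|: A) s)) /=; last first.
  by move=> u t; apply: agree_off_comp.
apply: eq_bigr => t st.
have h1 := mixO_agree na st; have h2 := mixO_agree' na st.
(* Resampling [A] after [D] leads from [s] to [t] through a single intermediate state. *)
rewrite (big_pred1 (mixO D s t)) => [|u]; last first.
  by apply/andP/eqP => [[su ut]|-> //]; exact: (mixO_uniq na).
set u := mixO D s t in h1 h2 *.
have h3 : agree_off (D :|: A) s u by apply: agree_off_sub h1; exact: subsetUl.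
rewrite (cmass_class mu (agree_off_equiv D) h1).
rewrite (cmass_class mu (agree_off_equiv (D :|: A)) h3).
have := cmass_mix u na.
have := cmass_gt0 mu_gt0 u (agree_off_refl D).
have := cmass_gt0 mu_gt0 u (agree_off_refl A).
have := cmass_gt0 mu_gt0 u (agree_off_refl (D :|: A)).
move: (mu_gt0 u); set a := mu u; set b := cmass _ _ _; set c := cmass _ _ _.
set d := cmass _ _ _ => a0 b0 c0 d0 e.
have -> : b = d * c / a by rewrite -e mulrC mulKf // gt_eqF.
by field; rewrite !gt_eqF.
Qed.

Lemma mean_block_comm D A f s : nonadjacent D A ->
  mean_block D (mean_block A f) s = mean_block A (mean_block D f) s.
Proof.
by move=> na; rewrite mean_block_setU // setUC -mean_block_setU // (unlinkedC interior_adj_sym).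
Qed.

Lemma mean_Ent_block_mean_block_le D A f : nonadjacent D A ->
  (forall s, 0 <= f s) ->
  mean_Ent_block A (mean_block D f) <= mean_Ent_block A f.
Proof.
move=> na f0; rewrite !mean_Ent_blockE mean_blockF; apply: cent_cexp_le => //.
- exact: mu_gt0.
- exact: agree_off_equiv.
- exact: agree_off_equiv.
- by move=> s; have := mean_block_comm f s na; rewrite !mean_blockF.
Qed.

Lemma mean_Ent_block_setU D A f : nonadjacent D A -> (forall s, 0 <= f s) ->
  mean_Ent_block (D :|: A) f - mean_Ent_block D f =
  mean_Ent_block A (mean_block D f).
Proof.
move=> na f0; rewrite mean_Ent_block_chain ?subsetUl //.
apply: eq_bigr => s _.
rewrite -mean_block_setU // mean_block_comm //.
set g := mean_block D (mean_block D f).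
have -> : g = mean_block D f; last by [].
apply/funext => t; rewrite /g !mean_blockF cexp_id //.
- exact: mu_gt0.
- exact: agree_off_refl.
- by move=> v tv; apply/esym/cexp_class => //; exact: agree_off_equiv.
Qed.

(** The increment over [D] is the entropy on [A] of the average of [f] over [D]. Passing from [D']
    to [D] is a further averaging, which commutes with that over [A] and can only decrease this
    entropy. *)
Lemma mean_Ent_block_submod D D' A f : D' \subset D -> nonadjacent D A ->
  (forall s, 0 <= f s) ->
  mean_Ent_block (D :|: A) f - mean_Ent_block D f <=
  mean_Ent_block (D' :|: A) f - mean_Ent_block D' f.
Proof.
move=> DD na f0; have na' := unlinkedS DD (subxx A) na.
rewrite !mean_Ent_block_setU //.
have -> : mean_block D f = mean_block D (mean_block D' f).
  apply/funext => s; rewrite !mean_blockF.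
  by rewrite (cexp_tower mu_gt0 f s (agree_off_equiv D') (agree_off_equiv D)
    (agree_off_sub DD)).
by apply: mean_Ent_block_mean_block_le => // s; apply: mean_block_ge0.
Qed.

End Gibbs.

(** * Pinnings, marginal bounds and covariances *)

Section LocalEntropyDecay.
Context {R : realType} {q : nat} {V W : finType}.
Variable S : spin_system R q V W.
Implicit Types (D A : {set V}) (s t u : Omega S) (f g : Omega S -> R).
Local Notation mu := (mu (S := S)).
Local Notation agr A := (@agree_off R q V W S A).
Local Notation mu_pos := (@mu_gt0 R q V W S).

Definition pin A s : partial_config :=
  [ffun x => if x \in A then None else Some (val s x)].

Lemma extends_pin A s t : extends (pin A s) t = agree_off A s t.
Proof.
apply/forallP/agree_offP => H x; first last.
  by rewrite ffunE; case: ifP => // /negbT /H ->; rewrite eqxx orbT.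
by move=> xA; have := H x; rewrite ffunE (negbTE xA) /= => /eqP[].
Qed.

Lemma pinning_pin A s : pinning S (pin A s).
Proof. by apply/existsP; exists s; rewrite extends_pin agree_off_refl. Qed.

Lemma muP_pin A s (P : pred (Omega S)) :
  muP (pin A s) P = cexp mu (agr A) (fun t => (P t)%:R) s.
Proof.
rewrite /muP /condPr /Pr /cexp.
have -> : \sum_(t | extends (pin A s) t) mu t = cmass mu (agr A) s.
  by apply: eq_bigl => t; exact: extends_pin.
rewrite mulr_suml big_mkcond [RHS]big_mkcond; apply: eq_bigr => t _ /=.
rewrite extends_pin; case: (P t); case: (agree_off A s t) => //=.
  by rewrite mulr1.
by rewrite mulr0.
Qed.

Lemma marginal_ge A s t x b : marginally_bounded S b -> agree_off A s t ->
  b <= cexp mu (agr A) (fun u => (val u x == val t x)%:R) s.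
Proof.
case=> _ H st; have := H _ (pinning_pin A s) x (val t x).
rewrite muP_pin; apply; rewrite inE; apply/existsP; exists t.
by rewrite extends_pin st /spin_at eqxx.
Qed.

(** The mean over [A] averages the mean over [A :\ x] over the spin at [x], and the spin of [s]
    there has probability at least [b]. *)
Lemma mean_block_le_marginal A s x f b : marginally_bounded S b ->
  (forall s, 0 <= f s) ->
  b * mean_block (A :\ x) f s <= mean_block A f s.
Proof.
move=> mb f0; rewrite !mean_blockE.
have sub : subrel (agr (A :\ x)) (agr A) by apply: agree_off_sub; exact: subD1set.
rewrite -(cexp_tower mu_pos f s (agree_off_equiv _) (agree_off_equiv _) sub).
have := marginal_ge x mb (agree_off_refl A s).
set g := cexp mu (agr (A :\ x)) f => h.
have g0 t : 0 <= g t by apply: cexp_ge0 => // *; exact: mu_pos.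
apply: (@le_trans _ _ (cexp mu (agr A) (fun u => (val u x == val s x)%:R * g s) s)).
  rewrite (_ : cexp _ _ _ s =
     cexp mu (agr A) (fun u => (val u x == val s x)%:R) s * g s).
    by rewrite ler_wpM2r.
  by rewrite mulrC -cexpZ; apply: eq_cexp => t _; rewrite mulrC.
apply: le_cexp; first exact: mu_pos.
move=> t st; case: eqP => [e|_]; last by rewrite mul0r.
rewrite mul1r /g (cexp_class mu f (agree_off_equiv (A :\ x)) (t := t)) //.
apply/agree_offP => y; rewrite !inE negb_and negbK => /orP[/eqP ->|yA] //.
by move/agree_offP : st; apply.
Qed.

Lemma cexp_spin A s x (phi : 'I_q -> R) :
  cexp mu (agr A) (fun t => phi (val t x)) s =
  \sum_a muP (pin A s) (spin_at (S := S) x a) * phi a.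
Proof.
under eq_bigr => a _ do rewrite muP_pin mulrC -cexpZ.
rewrite -cexp_sum; apply: eq_cexp => t _.
rewrite (bigD1 (val t x)) //= /spin_at eqxx mulr1 big1 ?addr0 // => a.
by rewrite eq_sym => /negbTE ->; rewrite mulr0.
Qed.

Lemma cexp_spin2 A s x y (phi : 'I_q -> 'I_q -> R) :
  cexp mu (agr A) (fun t => phi (val t x) (val t y)) s =
  \sum_a \sum_c muP (pin A s) (predI (spin_at (S := S) y c) (spin_at x a)) * phi a c.
Proof.
under eq_bigr => a _.
  under eq_bigr => c _ do rewrite muP_pin mulrC -cexpZ.
  rewrite -cexp_sum; over.
rewrite -cexp_sum; apply: eq_cexp => t _.
rewrite (bigD1 (val t x)) //= (bigD1 (val t y)) //= /spin_at !eqxx mulr1.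
rewrite !big1 ?addr0 // => [a ax|c]; last first.
  by rewrite eq_sym => /negbTE ->; rewrite mulr0.
by rewrite big1 // => c _; rewrite [val t x == a]eq_sym (negbTE ax) andbF mulr0.
Qed.

(** Weighted by the marginals [w], the influence matrix becomes the covariance matrix of the spin
    indicators without its blocks x = y. It is symmetric, so the reversible Rayleigh bound
    applies. *)
Lemma spectral_covariance_le A s (phi : V -> 'I_q -> R) eta :
  spectrally_independent S eta ->
  \sum_(x in A) \sum_(y in A :\ x)
    (cexp mu (agr A) (fun t => phi x (val t x) * phi y (val t y)) s -
     cexp mu (agr A) (fun t => phi x (val t x)) s *
     cexp mu (agr A) (fun t => phi y (val t y)) s) <=
  eta * \sum_(x in A) cexp mu (agr A) (fun t => phi x (val t x) ^+ 2) s.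
Proof.
move=> si; set tau := pin A s.
have pin_tau : pinning S tau by exact: pinning_pin.
pose w (p : V * 'I_q) := muP tau (spin_at (S := S) p.1 p.2).
(* [J2] extends the weighted matrix to all pairs; it vanishes at infeasible spins, so the sums can
   run over all spins. *)
pose J2 (p p' : V * 'I_q) := if p.1 == p'.1 then 0
  else muP tau (predI (spin_at (S := S) p'.1 p'.2) (spin_at p.1 p.2)) - w p * w p'.
have w_notin p : p.2 \notin spins S tau p.1 -> forall P : pred (Omega S),
    muP tau (predI P (spin_at p.1 p.2)) = 0.
  move=> pn P; rewrite muP_pin; apply: big1 => t st.
  suff /negbTE -> : ~~ predI P (spin_at p.1 p.2) t by rewrite mulr0.
  rewrite negb_and; apply/orP; right; apply: contra pn => tp.
  by rewrite inE; apply/existsP; exists t; rewrite extends_pin st.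
have w_notin1 p : p.2 \notin spins S tau p.1 -> w p = 0.
  by move=> /w_notin /(_ predT) <-; rewrite /w !muP_pin; apply: eq_cexp.
have w_gt0 p : p.2 \in spins S tau p.1 -> 0 < w p.
  rewrite inE => /existsP[t /andP[]]; rewrite extends_pin => st tp.
  rewrite /w muP_pin; apply: lt_le_trans (cexp_ge_term mu_pos _ st) => //.
  by rewrite tp mulr1 divr_gt0 ?mu_pos // cmass_gt0 //; [exact: mu_pos|exact: agree_off_refl].
have predIC_muP (P Q : pred (Omega S)) : muP tau (predI P Q) = muP tau (predI Q P).
  by rewrite !muP_pin; apply: eq_cexp => t _ /=; rewrite andbC.
have wJ p p' : p.2 \in spins S tau p.1 -> w p * influence_entry S tau p p' = J2 p p'.
  move=> /w_gt0 wp; rewrite /influence_entry /J2; case: eqP => _; first by rewrite mulr0.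
  rewrite mulrBr /cond_muP -/(w p) -/(w p') mulrC divfK ?gt_eqF //.
have J2sym p p' : J2 p p' = J2 p' p.
  by rewrite /J2 eq_sym; case: eqP => // _; rewrite predIC_muP mulrC.
have J20 p p' : p.2 \notin spins S tau p.1 -> J2 p p' = 0.
  move=> pn; rewrite /J2; case: eqP => // _.
  by rewrite (w_notin _ pn) (w_notin1 _ pn) mul0r subrr.
have feas p : (p \in feasible_pairs S tau) = (p.1 \in A) && (p.2 \in spins S tau p.1).
  by rewrite inE ffunE; case: (p.1 \in A).
have bev (F : V * 'I_q -> R) : \sum_(i < #|feasible_pairs S tau|) F (enum_val i) =
    \sum_(p in feasible_pairs S tau) F p by rewrite -big_enum_val.
have := @reversible_rayleigh_le R #|feasible_pairs S tau| (influence_matrix S tau)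
  (fun i => w (enum_val i)) eta (fun i => phi (enum_val i).1 (enum_val i).2).
have inF (i : 'I_#|feasible_pairs S tau|) :
    (enum_val i).2 \in spins S tau (enum_val i).1.
  by have := enum_valP i; rewrite feas => /andP[].
move=> /(_ (fun i => w_gt0 _ (inF i))).
have rev (i j : 'I_#|feasible_pairs S tau|) :
   w (enum_val i) * influence_matrix S tau i j =
   w (enum_val j) * influence_matrix S tau j i.
  by rewrite !mxE !wJ.
move=> /(_ rev (si _ pin_tau)).
have -> : \sum_(i < #|feasible_pairs S tau|) w (enum_val i) * phi (enum_val i).1 (enum_val i).2 ^+ 2 =
   \sum_(x in A) cexp mu (agr A) (fun t => phi x (val t x) ^+ 2) s.
  apply: (etrans (bev (fun p => w p * phi p.1 p.2 ^+ 2))).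
  under [RHS]eq_bigr => x _ do rewrite (cexp_spin A s x (fun a => phi x a ^+ 2)).
  rewrite pair_big_dep /= big_mkcond [RHS]big_mkcond; apply: eq_bigr => p _.
  rewrite feas andbT; case: (p.1 \in A) => //=; case: ifP => // /negbT /w_notin1.
  by rewrite /w => ->; rewrite mul0r.
have -> : \sum_(i < #|feasible_pairs S tau|) \sum_(j < #|feasible_pairs S tau|)
     w (enum_val i) * influence_matrix S tau i j *
     (phi (enum_val i).1 (enum_val i).2 * phi (enum_val j).1 (enum_val j).2) =
   \sum_(x in A) \sum_(y in A :\ x)
    (cexp mu (agr A) (fun t => phi x (val t x) * phi y (val t y)) s -
     cexp mu (agr A) (fun t => phi x (val t x)) s *
     cexp mu (agr A) (fun t => phi y (val t y)) s); last by [].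
under eq_bigr => i _ do under eq_bigr => j _ do rewrite mxE wJ //.
apply: (etrans (bev (fun p => \sum_(j < #|feasible_pairs S tau|) J2 p (enum_val j) *
     (phi p.1 p.2 * phi (enum_val j).1 (enum_val j).2)))).
under eq_bigr => p _ do rewrite (bev (fun p' => J2 p p' *
     (phi p.1 p.2 * phi p'.1 p'.2))) /=.
transitivity (\sum_(p : V * 'I_q | p.1 \in A) \sum_(p' : V * 'I_q | p'.1 \in A)
     J2 p p' * (phi p.1 p.2 * phi p'.1 p'.2)).
  rewrite big_mkcond [RHS]big_mkcond; apply: eq_bigr => p _.
  rewrite feas; case: (p.1 \in A) => //=; case: ifP => [_|/negbT pn]; last first.
    by rewrite big1 // => p' _; rewrite J20 // mul0r.
  rewrite big_mkcond [RHS]big_mkcond; apply: eq_bigr => p' _.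
  rewrite feas; case: (p'.1 \in A) => //=; case: ifP => [_|/negbT pn] //.
  by rewrite J2sym J20 // mul0r.
transitivity (\sum_(x in A) \sum_(a : 'I_q) \sum_(y in A) \sum_(c : 'I_q)
     J2 (x, a) (y, c) * (phi x a * phi y c)).
  rewrite [RHS]pair_big_dep /=; apply: eq_big => [[x a]|[x a] _] /=; first by rewrite andbT.
  by rewrite [RHS]pair_big_dep /=; apply: eq_big => [[y c]|[y c] _] //=; rewrite andbT.
apply: eq_bigr => x xA; rewrite exchange_big /= (big_setD1 x) //=.
rewrite big1 ?add0r => [|a _]; last first.
  by apply: big1 => c _; rewrite /J2 /= eqxx mul0r.
apply: eq_bigr => y; rewrite !inE eq_sym => /andP[yx _].
rewrite (cexp_spin2 A s x y (fun a c => phi x a * phi y c)) !cexp_spin.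
rewrite big_distrlr /= -sumrB; apply: eq_bigr => a _.
rewrite -sumrB; apply: eq_bigr => c _.
by rewrite /J2 /= (negbTE yx) /w /= -/tau; ring.
Qed.

End LocalEntropyDecay.

(** * Differences and Bernoulli averages of set functions *)

Section SetFunctions.
Context {R : realType} {V : finType}.
Implicit Types (h k : {set V} -> R) (A : {set V}).

Definition drop_sum h A : R := \sum_(x in A) (h A - h (A :\ x)).

(** Maximum principle: [k A] is at most the average of [k (A :\ x)] over [x] in [A]. *)
Lemma le_set0_drop_sum k : (forall A, drop_sum k A <= 0) ->
  forall A, k A <= k set0.
Proof.
move=> k0 A; have [n] := ubnP #|A|; elim: n A => // n IH A An.
have [->//|[x0 x0A]] := set_0Vmem A.
have A0 : (0 < #|A|)%N by rewrite card_gt0; apply/set0Pn; exists x0.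
suff : #|A|%:R * k A <= #|A|%:R * k set0 by rewrite ler_pM2l // ltr0n.
have H : #|A|%:R * k A <= \sum_(x in A) k (A :\ x).
  by rewrite mulr_natl -subr_le0; have := k0 A; rewrite /drop_sum sumrB sumr_const.
apply: (le_trans H); rewrite mulr_natl -sumr_const; apply: ler_sum => x xA; apply: IH.
by move: An; rewrite (cardsD1 x A) xA ltnS.
Qed.

(** The term y = x of [drop_sum h A] has no counterpart in [drop_sum h (A :\ x)] and yields the
    first-order part. *)
Lemma drop_sum_drop_sum h A : drop_sum (drop_sum h) A = drop_sum h A +
  \sum_(x in A) \sum_(y in A :\ x)
     (h A - h (A :\ x) - h (A :\ y) + h (A :\ x :\ y)).
Proof.
rewrite /drop_sum -big_split; apply: eq_bigr => x xA /=.
rewrite (big_setD1 x) //= -addrA; congr (_ + _).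
rewrite -sumrB; apply: eq_bigr => y _.
ring.
Qed.

(* The function drop_sum h - c h has nonpositive differences and vanishes at
   set0. *)
Lemma drop_sum_le h (c : R) : h set0 = 0 ->
  (forall A, drop_sum (drop_sum h) A <= c * drop_sum h A) ->
  forall A, drop_sum h A <= c * h A.
Proof.
move=> h0 H A; rewrite -subr_le0.
have <- : drop_sum h set0 - c * h set0 = 0.
  by rewrite h0 mulr0 subr0 /drop_sum big_set0.
apply: (le_set0_drop_sum (k := fun A => drop_sum h A - c * h A)) => B.
have := H B; rewrite -subr_le0; apply: le_trans.
rewrite le_eqVlt; apply/orP; left; apply/eqP.
by rewrite {2 3 4}/drop_sum mulr_sumr -sumrB; apply: eq_bigr => x _; ring.
Qed.

Lemma subset_average_ge h (N : nat) : (forall A, 0 <= h A) ->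
  (forall A, drop_sum h A <= N%:R * h A) ->
  forall A j, (N <= j <= #|A|)%N ->
  'C(#|A| - N, j - N)%:R * h A <= \sum_(B : {set V} | (B \subset A) && (#|B| == j)) h B.
Proof.
move=> h0 hN A; have [n] := ubnP #|A|; elim: n A => // n IH A An j /andP[Nj jA].
move: jA; rewrite leq_eqVlt => /orP[/eqP jA|jA].
  by rewrite jA binn mul1r (bigD1 A) ?subxx ?eqxx //= lerDl sumr_ge0.
set k := #|A|; have kj : (0 < k - j)%N by rewrite subn_gt0.
suff : (k - j)%:R * ('C(k - N, j - N)%:R * h A) <= (k - j)%:R *
    \sum_(B : {set V} | (B \subset A) && (#|B| == j)) h B.
  by rewrite ler_pM2l // ltr0n.
have -> : (k - j)%:R * (\sum_(B : {set V} | (B \subset A) && (#|B| == j)) h B) =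
    \sum_(x in A) \sum_(B : {set V} | (B \subset A :\ x) && (#|B| == j)) h B.
  rewrite mulr_sumr (exchange_big_dep (fun B : {set V} => (B \subset A) && (#|B| == j))) /=.
    apply: eq_bigr => B /andP[BA /eqP Bj].
    rewrite mulr_natl -Bj /k -cardsDS // -sumr_const; apply: eq_bigl => x.
    by rewrite inE subsetD1 BA /= eqxx andbT andbC.
  by move=> x B xA /andP[+ ->]; rewrite subsetD1 andbT => /andP[].
have kE x : x \in A -> #|A :\ x| = k.-1 by move=> xA; rewrite /k (cardsD1 x A) xA.
apply: (@le_trans _ _ (\sum_(x in A) 'C(k.-1 - N, j - N)%:R * h (A :\ x))); last first.
  apply: ler_sum => x xA; rewrite -(kE x xA); apply: IH.
    by move: An; rewrite (cardsD1 x A) xA ltnS.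
  by rewrite Nj (kE x xA) -ltnS prednK // (leq_ltn_trans _ jA).
rewrite -mulr_sumr mulrA.
have -> : (k - j)%:R * 'C(k - N, j - N)%:R = ('C(k.-1 - N, j - N) * (k - N))%:R :> R.
  rewrite -natrM; congr _%:R.
  have [m km] : exists m, k = (N + m.+1)%N.
    by exists (k - N).-1; rewrite prednK ?subnKC ?subn_gt0 ?(leq_ltn_trans Nj) // ltnW // (leq_ltn_trans Nj).
  have -> : (k - N = m.+1)%N by rewrite km addKn.
  have -> : (k.-1 - N = m)%N by rewrite km addnS /= addKn.
  have -> : (k - j = m.+1 - (j - N))%N by rewrite km subnBA // addnC.
  by rewrite -mul_bin_down mulnC.
rewrite natrM -mulrA ler_wpM2l ?ler0n //.
have := hN A; rewrite /drop_sum sumrB sumr_const -/k.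
rewrite natrB; last by apply: leq_trans Nj (ltnW jA).
by rewrite mulrBl [k%:R * _]mulr_natl; lra.
Qed.

Definition bern (th : R) (B : {set V}) : R := th ^+ #|B| * (1 - th) ^+ #|~: B|.

Lemma bern_ge0 th B : 0 <= th <= 1 -> 0 <= bern th B.
Proof. by move=> /andP[t0 t1]; rewrite mulr_ge0 // exprn_ge0 // subr_ge0. Qed.

Lemma bern_sum th : \sum_(B : {set V}) bern th B = 1.
Proof.
have : \prod_(x : V) (th + (1 - th)) = 1 by rewrite subrKC prodr_const expr1n.
rewrite bigA_distr => <-; apply: eq_bigr => B _.
rewrite (bigID (mem B)) /=.
rewrite (eq_bigr (fun=> th)) => [|x ->//].
rewrite [X in _ = _ * X](eq_bigr (fun=> 1 - th)) => [|x /negbTE ->//].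
by rewrite !prodr_const /bern cardsE; congr (_ * _ ^+ _); apply: eq_card => x; rewrite !inE.
Qed.

Lemma bernoulli_sum_ge h (N : nat) (th : R) : 0 <= th <= 1 ->
  (forall A, 0 <= h A) -> (forall A, drop_sum h A <= N%:R * h A) ->
  th ^+ N * h setT <= \sum_(B : {set V}) bern th B * h B.
Proof.
move=> th01 h0 hN; have /andP[th0 th1] := th01; set k := #|[set: V]|.
have th1' : 0 <= 1 - th by rewrite subr_ge0.
have bern0 B : 0 <= bern th B * h B by rewrite mulr_ge0 // bern_ge0.
have Ck (B : {set V}) : #|~: B| = (k - #|B|)%N by rewrite cardsCs setCK /k cardsT.
(* With [k < N] the term of [setT] alone suffices, since th^k >= th^N. *)
have [kN|Nk] := ltnP k N.
  rewrite (bigD1 setT) //= -[leLHS]addr0 lerD ?sumr_ge0 //.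
  rewrite /bern Ck subnn expr0 mulr1 ler_wpM2r //.
  by apply: ler_wiXn2l => //; apply: ltnW.
have Bk (B : {set V}) : (#|B| <= k)%N by rewrite subset_leq_card // subsetT.
rewrite (partition_big (fun B : {set V} => inord #|B| : 'I_k.+1) xpredT) //=.
(* The guard matters: for [j < N] truncated subtraction would turn the binomial into 1. With it, the
   binomial theorem for exponent [k - N] leaves [th ^+ N]. *)
apply: (@le_trans _ _ (\sum_(j < k.+1) th ^+ j * (1 - th) ^+ (k - j) *
    (if (N <= j)%N then 'C(k - N, j - N)%:R * h setT else 0))); last first.
  apply: ler_sum => j _.
  have jE (B : {set V}) : (inord #|B| == j) = (B \subset [set: V]) && (#|B| == j).
    by rewrite subsetT -val_eqE /= inordK ?ltnS ?Bk.
  rewrite (eq_bigl _ _ jE).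
  have -> : \sum_(B : {set V} | (B \subset setT) && (#|B| == j)) bern th B * h B =
      th ^+ j * (1 - th) ^+ (k - j) *
      \sum_(B : {set V} | (B \subset setT) && (#|B| == j)) h B.
    by rewrite mulr_sumr; apply: eq_bigr => B /andP[_ /eqP Bj]; rewrite /bern Ck Bj.
  apply: ler_wpM2l; first by rewrite mulr_ge0 // exprn_ge0.
  case: ifP => [Nj|_]; last by apply: sumr_ge0.
  by apply: subset_average_ge => //; rewrite Nj -ltnS ltn_ord.
rewrite le_eqVlt; apply/orP; left; apply/eqP.
rewrite -(subnKC Nk) -addnS big_split_ord /= big1 ?add0r => [|i _]; last first.
  by rewrite leqNgt ltn_ord mulr0.
have := exprDn (1 - th) th (k - N); rewrite subrK expr1n => e.
rewrite -[LHS]mulr1 [in LHS]e mulr_sumr; apply: eq_bigr => i _.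
rewrite leq_addr addKn exprD subnDl -mulr_natl addKn; ring.
Qed.

End SetFunctions.

(** * Spectral independence and differences of the block entropy *)

Section EntropyDifferences.
Context {R : realType} {q : nat} {V W : finType}.
Variable S : spin_system R q V W.
Implicit Types (D A : {set V}) (s t u : Omega S) (f g : Omega S -> R).
Local Notation mu := (mu (S := S)).
Local Notation agr A := (@agree_off R q V W S A).
Local Notation mu_pos := (@mu_gt0 R q V W S).

(** Test the covariance bound on the indicator of one spin at one vertex: all covariances of
    distinct vertices vanish, which leaves 0 <= eta X with X > 0. *)
Lemma spectral_bound_ge0 eta : inhabited (Omega S) -> (0 < #|V|)%N ->
  spectrally_independent S eta -> 0 <= eta.
Proof.
move=> [s] /card_gt0P[x0 _] si.
pose phi (x : V) (a : 'I_q) : R := ((x == x0) && (a == val s x0))%:R.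
have := spectral_covariance_le setT s phi si.
rewrite big1 => [|x _]; last first.
  apply: big1 => y; rewrite !inE andbT => yx.
  have [xx0|xx0] := boolP (x == x0).
    have y0 a : phi y a = 0 by rewrite /phi -(eqP xx0) (negbTE yx).
    under eq_cexp => t _ do rewrite y0 mulr0.
    under [X in _ - _ * X]eq_cexp => t _ do rewrite y0.
    by rewrite (cexp_cst mu_pos) ?mulr0 ?subrr //; exact: agree_off_refl.
  have y0 a : phi x a = 0 by rewrite /phi (negbTE xx0).
  under eq_cexp => t _ do rewrite y0 mul0r.
  under [X in _ - X * _]eq_cexp => t _ do rewrite y0.
  by rewrite (cexp_cst mu_pos) ?mul0r ?subrr //; exact: agree_off_refl.
set X := \sum_(x in _) _ => h.
suff X0 : 0 < X by rewrite -(pmulr_lge0 _ X0).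
have X1 x : 0 <= cexp mu (agr setT) (fun t => phi x (val t x) ^+ 2) s.
  by apply: cexp_ge0 => [|t _]; [exact: mu_pos | exact: sqr_ge0].
rewrite /X (bigD1 x0) ?inE //= ltr_wpDr ?sumr_ge0 //.
apply: cexp_gt0 => [||t|]; [exact: mu_pos|exact: agree_off_refl|exact: sqr_ge0|].
by rewrite /phi !eqxx expr1n.
Qed.

Lemma expect_class A f g : (forall s t, agree_off A s t -> g s = g t) ->
  expect mu (fun s => g s * f s) =
  expect mu (fun s => g s * cexp mu (agr A) f s).
Proof.
move=> gc; rewrite -(expect_cexp mu_pos _ (agree_off_equiv A)).
by apply: eq_expect => s; apply: cexp_mull => t /gc ->.
Qed.

Lemma marginal_bound_le1 b : inhabited (Omega S) -> (0 < #|V|)%N ->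
  marginally_bounded S b -> b <= 1.
Proof.
move=> [s] /card_gt0P[x _] mb.
apply: (le_trans (marginal_ge x mb (agree_off_refl setT s))).
rewrite -[leRHS](cexp_cst mu_pos 1 s (agree_off_refl setT)).
apply: le_cexp; first exact: mu_pos.
by move=> t _; rewrite lern1 leq_b1.
Qed.

Lemma sum_second_diff_le A f eta b : inhabited (Omega S) -> 0 <= eta -> spectrally_independent S eta ->
  marginally_bounded S b -> (forall s, 0 <= f s) ->
  \sum_(x in A) \sum_(y in A :\ x)
    (mean_Ent_block A f - mean_Ent_block (A :\ x) f - mean_Ent_block (A :\ y) f
      + mean_Ent_block (A :\ x :\ y) f) <=
  4 * eta / b * drop_sum (fun D => mean_Ent_block D f) A.
Proof.
move=> inh eta0 si mb f0; have [b0 _] := mb.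
set g := cexp mu (agr A) f.
pose gx x := cexp mu (agr (A :\ x)) f.
pose F x s := gx x s / g s - 1.
have sub x : subrel (agr (A :\ x)) (agr A) by apply: agree_off_sub; exact: subD1set.
have g0 s : 0 <= g s by apply: cexp_ge0 => //; exact: mu_pos.
have gc s t : agree_off A s t -> g s = g t.
  by move=> st; apply: cexp_class => //; exact: agree_off_equiv.
apply: (@le_trans _ _ (\sum_(x in A) \sum_(y in A :\ x)
   expect mu (fun s => g s * (F x s * F y s)))).
  apply: ler_sum => x xA; apply: ler_sum => y yA; rewrite !mean_Ent_blockE.
  apply: cent_second_diff_le => //; try exact: agree_off_equiv.
  - exact: mu_pos.
  - by apply: agree_off_sub; exact: subD1set.
  - by apply: agree_off_sub; rewrite setDDl setUC -setDDl subD1set.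
apply: (@le_trans _ _ (eta * \sum_(x in A) expect mu (fun s => g s * F x s ^+ 2))).
  under eq_bigr => x _ do rewrite -expect_sum.
  rewrite -expect_sum -expect_sum -expectZ.
  have -> : expect mu (fun s => \sum_(x in A) \sum_(y in A :\ x) g s * (F x s * F y s))
    = expect mu (fun s => g s * cexp mu (agr A)
        (fun t => \sum_(x in A) \sum_(y in A :\ x) F x t * F y t) s).
    rewrite -expect_class //; apply: eq_expect => s; rewrite mulr_sumr.
    by apply: eq_bigr => x _; rewrite mulr_sumr.
  have -> : expect mu (fun s => eta * \sum_(x in A) g s * F x s ^+ 2)
    = expect mu (fun s => g s * cexp mu (agr A)
        (fun t => eta * \sum_(x in A) F x t ^+ 2) s).
    rewrite -expect_class //; apply: eq_expect => s; rewrite mulrCA -mulr_sumr.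
    by [].
  apply: le_expect => [|s]; first exact: mu_pos.
  have [gs0|gsn0] := eqVneq (g s) 0; first by rewrite gs0 !mul0r.
  apply: ler_wpM2l => //.
  rewrite cexpZ !cexp_sum.
  (* Within the class of [s], [F x] depends on the spin at [x] only, since [gx x] averages over the
     rest of [A]. [phi] turns it into a function of that spin, 0 at infeasible ones. *)
  pose phi (x : V) (a : 'I_q) : R :=
    if [pick t | agree_off A s t && (val t x == a)] is Some t then F x t else 0.
  have phiE x t : x \in A -> agree_off A s t -> F x t = phi x (val t x).
    move=> xA st; rewrite /phi; case: pickP => [u /andP[su /eqP ux]|/(_ t)]; last first.
      by rewrite st eqxx.
    rewrite /F -(gc _ _ su) -(gc _ _ st); congr (_ / _ - 1).
    apply: cexp_class; first exact: agree_off_equiv.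
    apply/agree_offP => z; rewrite !inE negb_and negbK => /orP[/eqP -> //|zA].
    by rewrite -(agree_offP _ _ _ st) // -(agree_offP _ _ _ su).
  (* Centred by the tower property, so covariances are expectations of products. *)
  have phi0 x : x \in A -> cexp mu (agr A) (fun t => phi x (val t x)) s = 0.
    move=> xA; rewrite -[LHS](@eq_cexp _ _ mu _ (F x)); last by move=> t st; exact: phiE.
    rewrite /F cexpB (cexp_cst mu_pos); last exact: agree_off_refl.
    rewrite (@eq_cexp _ _ mu _ _ (fun t => (g s)^-1 * gx x t)); last first.
      by move=> t /gc <-; rewrite mulrC.
    rewrite cexpZ (cexp_tower mu_pos f s (agree_off_equiv _) (agree_off_equiv _) (sub x)).
    by rewrite mulVf ?subrr.
  have := spectral_covariance_le A s phi si.
  rewrite (eq_bigr (fun x => cexp mu (agr A) (fun t => \sum_(y in A :\ x) F x t * F y t) s)).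
    rewrite [X in _ <= eta * X](eq_bigr (fun x => cexp mu (agr A) (fun t => F x t ^+ 2) s)) //.
    by move=> x xA; apply: eq_cexp => t st; rewrite phiE.
  move=> x xA; rewrite cexp_sum; apply: eq_bigr => y yA; rewrite phi0 // mul0r subr0.
  apply: eq_cexp => t st; rewrite -!phiE //; by move: yA; rewrite inE => /andP[].
rewrite /drop_sum -[4 * eta / b]mulrA [4 * _]mulrCA -mulrA.
apply: ler_wpM2l => //; rewrite mulr_sumr; apply: ler_sum => x xA.
rewrite -[4 / b]/(4 * b^-1) !mean_Ent_blockE.
(* Here [M] is [b^-1], admissible by [mean_block_le_marginal]. *)
apply: cond_variance_le_entropy => //; try exact: agree_off_equiv.
- exact: mu_pos.
- by rewrite invf_ge1 // (marginal_bound_le1 inh _ mb) //; apply/card_gt0P; exists x.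
- move=> s; rewrite ler_pdivlMl //.
  by have := mean_block_le_marginal A s x mb f0; rewrite !mean_blockE.
Qed.

Lemma drop_sum_entropy_le f eta b : inhabited (Omega S) -> 0 <= eta ->
  spectrally_independent S eta -> marginally_bounded S b -> (forall s, 0 <= f s) ->
  forall A, drop_sum (fun D => mean_Ent_block D f) A <=
            (1 + 4 * eta / b) * mean_Ent_block A f.
Proof.
move=> inh eta0 si mb f0; apply: drop_sum_le.
  exact: mean_Ent_block_set0.
move=> A; rewrite drop_sum_drop_sum mulrDl mul1r lerD2l.
exact: sum_second_diff_le.
Qed.

End EntropyDifferences.

(** * Entropy against the oscillation of the square root *)

Section CrudeTensorization.
Context {R : realType} {T : finType}.
Variable mu : T -> R.
Hypothesis mu_gt0 : forall s, 0 < mu s.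
Implicit Types (e : rel T) (f g : T -> R).

(** Averaged form of [xlnx_div_ge_sqrt]: with m the mean of f, the mean square of sqrt f - sqrt m is
    2 m minus twice sqrt m times the mean of sqrt f. *)
Lemma cexp_entropy_ge_sqrt e f s : equivalence_rel e -> (forall t, 0 <= f t) ->
  cexp mu e (fun t => (Num.sqrt (f t) - Num.sqrt (cexp mu e f s)) ^+ 2) s <=
  cexp mu e (fun t => f t * ln (f t / cexp mu e f t)) s.
Proof.
move=> ee f0; have er : reflexive e by have [] := (equivalence_relP e).1 ee.
set m := cexp mu e f s.
have m0 : 0 <= m by exact: cexp_ge0.
apply: (@le_trans _ _ (cexp mu e
    (fun t => 2 * f t - 2 * Num.sqrt m * Num.sqrt (f t)) s)).
  under eq_cexp => t _ do rewrite sqrrB !sqr_sqrtr // -mulr_natr -mulrA.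
  rewrite cexpD cexpB !(cexpB, cexpZ) (cexp_cst mu_gt0) // -/m.
  rewrite (@eq_cexp _ _ mu _ (fun t => _ * (_ * _)) (fun t => 2 * Num.sqrt m * Num.sqrt (f t))).
    by rewrite cexpZ; lra.
  by move=> t _; ring.
apply: le_cexp => // t st; rewrite -(cexp_class mu f ee st) -/m.
rewrite -mulrA [Num.sqrt m * _]mulrC.
apply: xlnx_div_ge_sqrt => // ft; rewrite /m (cexp_class mu f ee st).
exact: cexp_gt0.
Qed.

(** By ln u <= u - 1 the entropy is at most the variance over the mean m. Since f <= m / b, two
    values of f differ in square by at most 4 (m / b) D^2. *)
Lemma cexp_entropy_le_osc e f s (b D : R) : equivalence_rel e -> (forall t, 0 <= f t) ->
  0 < b -> 0 <= D -> (forall t, e s t -> b <= mu t / cmass mu e s) ->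
  (forall t u, e s t -> e s u -> `|Num.sqrt (f t) - Num.sqrt (f u)| <= D) ->
  cexp mu e (fun t => f t * ln (f t / cexp mu e f t)) s <= 4 / b * D ^+ 2.
Proof.
move=> ee f0 b0 D0 pb osc; have er : reflexive e by have [] := (equivalence_relP e).1 ee.
set m := cexp mu e f s.
have mE t : e s t -> cexp mu e f t = m by move=> st; rewrite /m (cexp_class mu f ee st).
have m_ge0 : 0 <= m by exact: cexp_ge0.
have rhs0 : 0 <= 4 / b * D ^+ 2 by rewrite mulr_ge0 ?sqr_ge0 // divr_ge0 // ltW.
have fm t : e s t -> f t <= m / b.
  move=> st; rewrite ler_pdivlMr // mulrC.
  apply: (le_trans _ (cexp_ge_term mu_gt0 (fun u _ => f0 u) st)).
  by rewrite ler_wpM2r // pb.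
have [m0|mn0] := eqVneq m 0.
  rewrite [leLHS](_ : _ = 0) //; apply: big1 => t st.
  suff -> : f t = 0 by rewrite mul0r mulr0.
  by apply/eqP; rewrite eq_le f0 andbT; have := fm t st; rewrite m0 mul0r.
have mp : 0 < m by rewrite lt_neqAle eq_sym mn0.
have sd t u : e s t -> e s u -> (f t - f u) ^+ 2 <= 4 * (m / b) * D ^+ 2.
  move=> st su.
  have -> : (f t - f u) ^+ 2 = (Num.sqrt (f t) + Num.sqrt (f u)) ^+ 2 *
      (Num.sqrt (f t) - Num.sqrt (f u)) ^+ 2.
    rewrite -{1}(sqr_sqrtr (f0 t)) -{1}(sqr_sqrtr (f0 u)); ring.
  apply: ler_pM; try exact: sqr_ge0.
    have := sqr_ge0 (Num.sqrt (f t) - Num.sqrt (f u)).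
    have := fm t st; have := fm u su.
    rewrite sqrrB sqrrD !sqr_sqrtr //; lra.
  by rewrite -real_normK ?num_real //; apply: lerXn2r; rewrite ?nnegrE // osc.
pose X := Num.sqrt (4 * (m / b) * D ^+ 2).
have X2 : X ^+ 2 = 4 * (m / b) * D ^+ 2.
  by rewrite sqr_sqrtr // !mulr_ge0 ?sqr_ge0 ?invr_ge0 // ltW.
have dm t : e s t -> (f t - m) ^+ 2 <= X ^+ 2.
  move=> st; have H u : e s u -> `|f t - f u| <= X.
    move=> su; rewrite -sqrtr_sqr /X ler_wsqrtr //; exact: sd.
  have X0 : 0 <= X by rewrite sqrtr_ge0.
  have h1 : f t - m <= X.
    rewrite -(cexp_cst mu_gt0 (f t) s er) /m -cexpB -[leRHS](cexp_cst mu_gt0 X s er).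
    by apply: le_cexp => // u su; apply: le_trans (ler_norm _) (H u su).
  have h2 : m - f t <= X.
    rewrite -(cexp_cst mu_gt0 (f t) s er) /m -cexpB -[leRHS](cexp_cst mu_gt0 X s er).
    by apply: le_cexp => // u su; apply: le_trans (ler_norm _) _; rewrite distrC H.
  rewrite -real_normK ?num_real //; apply: lerXn2r; rewrite ?nnegrE //.
  by rewrite ler_norml; apply/andP; split; lra.
apply: (@le_trans _ _ (cexp mu e (fun t => m^-1 * (f t - m) ^+ 2 + (f t - m)) s)).
  apply: le_cexp => // t st; rewrite mE //.
  have [->|fn0] := eqVneq (f t) 0.
    rewrite mul0r sub0r sqrrN expr2 mulrA mulVf // mul1r; lra.
  have fp : 0 < f t by rewrite lt_neqAle eq_sym fn0 f0.
  apply: (@le_trans _ _ (f t * (f t / m - 1))).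
    by apply: ler_wpM2l => //; apply: ln_le_subr1; rewrite divr_gt0.
  by rewrite le_eqVlt; apply/orP; left; apply/eqP; field.
rewrite cexpD cexpB (cexp_cst mu_gt0) // -/m subrr addr0 cexpZ.
rewrite mulrC ler_pdivrMr //.
apply: (@le_trans _ _ (cexp mu e (fun=> X ^+ 2) s)).
  by apply: le_cexp => // t st; exact: dm.
rewrite (cexp_cst mu_gt0) // X2 le_eqVlt; apply/orP; left; apply/eqP; ring.
Qed.

End CrudeTensorization.

(** * Tensorization on a block by total connectivity *)

Section CrudeBlock.
Context {R : realType} {q : nat} {V W : finType}.
Variable S : spin_system R q V W.
Implicit Types (D A : {set V}) (s t u : Omega S) (f g : Omega S -> R).
Local Notation mu := (mu (S := S)).
Local Notation agr A := (@agree_off R q V W S A).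
Local Notation mu_pos := (@mu_gt0 R q V W S).

(** One vertex at a time: the conditional probability of [t] is the marginal of its spin at [x]
    times its probability on [A :\ x] given that spin. *)
Lemma conditional_prob_ge A s t b : marginally_bounded S b -> agree_off A s t ->
  b ^+ #|A| <= mu t / cmass mu (agr A) s.
Proof.
move=> mb; have [b0 _] := mb; have [n] := ubnP #|A|.
elim: n A s => // n IH A s An st.
have [A0|[x xA]] := set_0Vmem A.
  rewrite A0 cards0 expr0; move: st; rewrite A0 agree_off0 => /eqP <-.
  rewrite /cmass (big_pred1 s) => [|u]; last by rewrite agree_off0 eq_sym.
  by rewrite divff // gt_eqF // mu_pos.
have Ax : #|A| = #|A :\ x|.+1 by rewrite (cardsD1 x A) xA.
have h1 := IH (A :\ x) t; rewrite -ltnS -Ax in h1.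
have {}h1 := h1 An (agree_off_refl _ t).
have h2 := marginal_ge x mb st.
have c0 : 0 < cmass mu (agr (A :\ x)) t.
  by apply: cmass_gt0; [exact: mu_pos | exact: agree_off_refl].
have d0 : 0 < cmass mu (agr A) s.
  by apply: cmass_gt0; [exact: mu_pos | exact: agree_off_refl].
have e : cexp mu (agr A) (fun u => (val u x == val t x)%:R) s =
    cmass mu (agr (A :\ x)) t / cmass mu (agr A) s.
  rewrite /cexp [cmass mu (agr (A :\ x)) t]/cmass mulr_suml big_mkcond [RHS]big_mkcond.
  apply: eq_bigr => u _; have -> : agree_off (A :\ x) t u =
      agree_off A s u && (val u x == val t x).
    apply/agree_offP/andP => [tu|[/agree_offP su /eqP ux] z].
      split; last by rewrite tu // !inE eqxx.
      apply/agree_offP => z zA; rewrite (agree_offP _ _ _ st) //.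
      by rewrite tu // !inE negb_and zA orbT.
    rewrite !inE negb_and negbK => /orP[/eqP -> //|zA].
    by rewrite -(agree_offP _ _ _ st) // su.
  by case: (agree_off A s u) => //=; case: eqP => _; rewrite ?mulr1 ?mulr0.
rewrite e in h2.
rewrite Ax exprS.
have -> : mu t / cmass mu (agr A) s =
  cmass mu (agr (A :\ x)) t / cmass mu (agr A) s * (mu t / cmass mu (agr (A :\ x)) t).
  by field; rewrite !gt_eqF.
by apply: ler_pM => //; [exact: ltW | rewrite exprn_ge0 // ltW].
Qed.

Lemma class_card_le A s b : marginally_bounded S b ->
  #|[set t | agree_off A s t]|%:R <= (b ^+ #|A|)^-1.
Proof.
move=> mb; have [b0 _] := mb; have p0 : 0 < b ^+ #|A| by rewrite exprn_gt0.
rewrite -[leRHS]mul1r ler_pdivlMr //.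
rewrite -[leRHS](cprob_sum mu_pos s (agree_off_refl A)).
rewrite mulr_natl -sumr_const; rewrite [leRHS](eq_bigl (mem [set t | agree_off A s t])).
  apply: ler_sum => t; rewrite inE => st; exact: conditional_prob_ge.
by move=> t; rewrite !inE.
Qed.

(** Total connectivity gives a path of single-site moves inside the class; without repetitions it
    has fewer steps than the class has elements. *)
Lemma oscillation_le A s (K : Omega S -> R) (M : R) : totally_connected S ->
  0 <= M ->
  (forall u v, agree_off A s u -> agree_off A s v -> hamming u v = 1%N ->
    `|K u - K v| <= M) ->
  forall t u, agree_off A s t -> agree_off A s u ->
    `|K t - K u| <= #|[set t | agree_off A s t]|%:R * M.
Proof.
move=> tc M0 H t u st su.
have := tc _ (pinning_pin A s) t u; rewrite !extends_pin => /(_ st su).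
move=> /connectP[p0 p0P ->]; case/shortenP : p0P => p pP pU _ {su p0 u}.
have sz : (size p <= #|[set t | agree_off A s t]|)%N.
  have : {subset t :: p <= [set t | agree_off A s t]}.
    move=> v; rewrite !inE => /predU1P[->//|].
    elim: p t st pP {pU} => // w p IH t st /= /andP[/and3P[_ sw _] pP].
    rewrite inE => /predU1P[->|]; first by rewrite -extends_pin.
    by apply: IH pP; rewrite -extends_pin.
  move/subsetP/subset_leq_card; rewrite (card_uniqP pU) /=; exact: ltnW.
apply: (@le_trans _ _ ((size p)%:R * M)); last by rewrite ler_wpM2r // ler_nat.
elim: p t st pP {pU sz} => [|w p IH] t st /=.
  by move=> _; rewrite subrr normr0 mul0r.
move=> /andP[/and3P[_ sw /eqP tw] pP].
rewrite extends_pin in sw; have := IH _ sw pP; have := H _ _ st sw tw.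
have := ler_normD (K t - K w) (K w - K (last w p)).
by rewrite addrA subrK -natr1 mulrDl mul1r; lra.
Qed.

Lemma hamming1P u v : hamming u v = 1%N ->
  exists2 x, val u x != val v x & agree_off [set x] u v.
Proof.
rewrite /hamming => /eqP/cards1P[x xE]; exists x.
  by have := set11 x; rewrite -xE inE.
apply/agree_offP => y yx; apply/eqP; apply: contraNT yx => uv.
by rewrite -xE inE.
Qed.

(* The entropy is compared with the oscillation of sqrt f, which is at most the
   number of configurations times the largest increment along a single-site
   move. *)
Lemma mean_Ent_block_le_sites A f b : totally_connected S ->
  marginally_bounded S b -> (forall s, 0 <= f s) ->
  mean_Ent_block A f <=
  8 / b ^+ (4 * #|A|).+1 * \sum_(x in A) mean_Ent_block [set x] f.
Proof.
move=> tc mb f0; have [b0 _] := mb.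
pose ent D s := f s * ln (f s / cexp mu (agr D) f s).
have entE D : mean_Ent_block D f = expect mu (cexp mu (agr A) (ent D)).
  by rewrite (expect_cexp mu_pos) ?mean_Ent_blockE //; exact: agree_off_equiv.
rewrite entE; under eq_bigr => x _ do rewrite entE.
rewrite -expect_sum -expectZ; apply: le_expect; first exact: mu_pos.
move=> s; set Q := \sum_(x in A) _.
have p0 n : 0 < b ^+ n by rewrite exprn_gt0.
have sub1 x : x \in A -> subrel (agr [set x]) (agr A).
  by move=> xA; apply: agree_off_sub; rewrite sub1set.
(* Keep only [u] and [v] in the lower bound of the entropy at [x]: each has probability at least
   [b], and [u] has probability at least [b ^+ #|A|] in the large class. *)
have lower x u : x \in A -> agree_off A s u -> forall v, agree_off [set x] u v -> u != v ->
    b ^+ #|A| * (b / 2 * (Num.sqrt (f u) - Num.sqrt (f v)) ^+ 2) <=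
    cexp mu (agr A) (ent [set x]) s.
  move=> xA su v uv uneqv.
  pose k t := cexp mu (agr [set x]) (ent [set x]) t.
  have ge_sq t := cexp_entropy_ge_sqrt mu_pos t (agree_off_equiv [set x]) f0.
  have k0 t : 0 <= k t.
    apply: le_trans (ge_sq t); apply: cexp_ge0 => [|w _]; first exact: mu_pos.
    exact: sqr_ge0.
  rewrite -(cexp_tower mu_pos (ent [set x]) s (agree_off_equiv _) (agree_off_equiv _) (sub1 _ xA)).
  apply: le_trans (cexp_ge_term mu_pos (fun t _ => k0 t) su).
  apply: ler_pM; [exact: ltW| |exact: conditional_prob_ge|].
    by rewrite mulr_ge0 ?sqr_ge0 // divr_ge0 // ltW.
  apply: le_trans (ge_sq u); set m := Num.sqrt (cexp mu (agr [set x]) f u).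
  rewrite /cexp (bigD1 u) /=; last exact: agree_off_refl.
  rewrite (bigD1 v) /=; last by rewrite uv eq_sym.
  have pu := conditional_prob_ge mb (agree_off_refl [set x] u).
  have pv := conditional_prob_ge mb uv.
  rewrite cards1 expr1 in pu pv.
  set a := Num.sqrt (f u); set c := Num.sqrt (f v).
  have h1 := ler_wpM2r (sqr_ge0 (a - m)) pu.
  have h2 := ler_wpM2r (sqr_ge0 (c - m)) pv.
  have h3 : b / 2 * (a - c) ^+ 2 <= b * (a - m) ^+ 2 + b * (c - m) ^+ 2.
    rewrite -mulrDr -mulrA ler_pM2l //.
    have := sqr_ge0 (a + c - 2 * m); rewrite !(sqrrD, sqrrB, sqrrN, expr2); lra.
  rewrite addrA; apply: ler_wpDr; last by lra.
  apply: sumr_ge0 => t _; apply: mulr_ge0 (sqr_ge0 _); apply: cprob_ge0; exact: mu_pos.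
have ent_ge0 x : x \in A -> 0 <= cexp mu (agr A) (ent [set x]) s.
  move=> xA; rewrite -(cexp_tower mu_pos (ent [set x]) s (agree_off_equiv _) (agree_off_equiv _) (sub1 _ xA)).
  apply: cexp_ge0 => [|t _]; first exact: mu_pos.
  apply: le_trans (cexp_entropy_ge_sqrt mu_pos t (agree_off_equiv [set x]) f0).
  by apply: cexp_ge0 => [|w _]; [exact: mu_pos|exact: sqr_ge0].
have Q0 : 0 <= Q by exact: sumr_ge0.
pose M := Num.sqrt (2 / b ^+ #|A|.+1 * Q).
have M2 : M ^+ 2 = 2 / b ^+ #|A|.+1 * Q.
  by rewrite sqr_sqrtr // mulr_ge0 // divr_ge0 // ltW.
have edge u v : agree_off A s u -> agree_off A s v -> hamming u v = 1%N ->
    `|Num.sqrt (f u) - Num.sqrt (f v)| <= M.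
  move=> su sv /hamming1P[x uvx uv].
  have xA : x \in A.
    apply: contraNT uvx => xA.
    by rewrite -(agree_offP _ _ _ su) // -(agree_offP _ _ _ sv).
  have uneqv : u != v by apply: contraNneq uvx => ->.
  rewrite -sqrtr_sqr ler_wsqrtr //.
  have := lower x u xA su v uv uneqv.
  have : cexp mu (agr A) (ent [set x]) s <= Q.
    rewrite /Q (bigD1 x) //= lerDl; apply: sumr_ge0 => y /andP[yA _]; exact: ent_ge0.
  move=> h1 h2; have := le_trans h2 h1 => {h1 h2}.
  rewrite (_ : 2 / _ * Q = 2 * Q / b ^+ #|A|.+1); last by rewrite mulrAC.
  rewrite ler_pdivlMr // (exprSr b); set X := (_ - _) ^+ 2; set B := b ^+ _ => h.
  by rewrite (_ : X * (B * b) = 2 * (B * (b / 2 * X))) ?ler_pM2l //; field.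
have M0 : 0 <= M by rewrite sqrtr_ge0.
have osc := oscillation_le tc M0 edge.
set N := #|[set t | agree_off A s t]|%:R in osc.
have NM0 : 0 <= N * M by rewrite mulr_ge0 // ler0n.
apply: le_trans (cexp_entropy_le_osc mu_pos (agree_off_equiv A) f0 (p0 #|A|) NM0 _ osc) _.
  by move=> t st; exact: conditional_prob_ge.
rewrite exprMn M2.
have N2 : N ^+ 2 <= (b ^+ #|A|)^-1 ^+ 2.
  apply: lerXn2r; [by rewrite nnegrE ler0n | by rewrite nnegrE invr_ge0 ltW|].
  exact: class_card_le.
(* With s = #|A|, the factors b^(- s), b^(- 2 s) and b^(- s - 1) come from the entropy bound, the
   squared path length and the squared increment. *)
apply: (@le_trans _ _ (4 / b ^+ #|A| * ((b ^+ #|A|)^-1 ^+ 2 * (2 / b ^+ #|A|.+1 * Q)))).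
  apply: ler_wpM2l; first by rewrite divr_ge0 // ltW.
  by apply: ler_wpM2r => //; rewrite mulr_ge0 // divr_ge0 // ltW.
rewrite le_eqVlt; apply/orP; left; apply/eqP.
rewrite !exprS mulnC exprM; field.
by rewrite !gt_eqF // p0.
Qed.

End CrudeBlock.

(** * From a sparse random set to its isolated vertices *)

Section IsolatedVertices.
Context {R : realType} {V : finType}.
Implicit Types (A B D I J : {set V}).
Variables (e : rel V) (h : {set V} -> R).
Hypothesis e_sym : symmetric e.
Hypothesis e_irr : irreflexive e.
Hypothesis h_ge0 : forall A, 0 <= h A.
Hypothesis h_mono : forall D A, D \subset A -> h D <= h A.
Hypothesis h_submod : forall D' D A : {set V}, D' \subset D -> unlinked e D A ->
  h (D :|: A) - h D <= h (D' :|: A) - h D'.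
Local Notation isolated := (isolated_vertices e).

Lemma h_submod1 I D' D x : independent e I -> D' \subset D -> D \subset I ->
  x \in I -> x \notin D -> h (x |: D) - h D <= h (x |: D') - h D'.
Proof.
move=> Iind D'D DI xI xD; rewrite ![x |: _]setUC; apply: h_submod => //.
exact: (independent_unlinked Iind).
Qed.

(** Remove the vertices one at a time: by submodularity each difference at [I] is at most the one at
    its stage, and the latter telescope. *)
Lemma drop_sum_independent_le I : independent e I -> drop_sum h I <= h I.
Proof.
move=> Iind.
suff H J : J \subset I -> \sum_(x in J) (h I - h (I :\ x)) <= h I - h (I :\: J).
  by have := H I (subxx I); rewrite setDv; have := h_ge0 set0; rewrite /drop_sum; lra.
have [n] := ubnP #|J|; elim: n J => // n IH J Jn JI.
have [->|[x xJ]] := set_0Vmem J; first by rewrite big_set0 setD0 subrr.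
have Jx : (#|J :\ x| < n)%N by move: Jn; rewrite (cardsD1 x J) xJ ltnS.
have JxI : J :\ x \subset I by apply: subset_trans JI; exact: subD1set.
have xI := subsetP JI _ xJ.
rewrite (big_setD1 x) //=; have := IH _ Jx JxI.
have E : I :\: (J :\ x) = x |: (I :\: J).
  apply/setP => y; rewrite !inE; case: eqP => [->|_] /=; first by rewrite xI.
  by rewrite ?andbT.
have E2 : I = x |: (I :\ x) by rewrite setD1K.
have := @h_submod1 I (I :\: J) (I :\ x) x Iind _ _ xI _.
rewrite E -E2 subD1set !inE eqxx /= => /(_ _ isT isT).
have sub : I :\: J \subset I :\ x by apply: setDS; rewrite sub1set.
by move=> /(_ sub); lra.
Qed.

(** Adding [x] changes [h (B :&: I)] only for [B] containing [x], there by at least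
    [h I - h (I :\ x)]; such [B] have total weight at least [d]. *)
Lemma shearer_independent_le (alpha : {set V} -> R) (d : R) I :
  (forall B, 0 <= alpha B) -> h set0 = 0 ->
  (forall x, d <= \sum_(B : {set V} | x \in B) alpha B) ->
  independent e I -> d * h I <= \sum_(B : {set V}) alpha B * h (B :&: I).
Proof.
move=> al0 h00 dle; have [n] := ubnP #|I|; elim: n I => // n IH I In Iind.
have [->|[x xI]] := set_0Vmem I.
  by rewrite h00 mulr0 big1 // => B _; rewrite setI0 h00 mulr0.
have Ix : (#|I :\ x| < n)%N by move: In; rewrite (cardsD1 x I) xI ltnS.
have := IH _ Ix (independentS (subD1set I x) Iind).
set X := \sum_(B : {set V}) _ => hX.
have E2 : I = x |: (I :\ x) by rewrite setD1K.
have dI : 0 <= h I - h (I :\ x) by rewrite subr_ge0 h_mono // subD1set.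
apply: (@le_trans _ _ (X + (\sum_(B : {set V} | x \in B) alpha B) * (h I - h (I :\ x)))).
  by have := ler_wpM2r dI (dle x); lra.
rewrite mulr_suml [X in _ + X]big_mkcond -big_split /=; apply: ler_sum => B _.
case: ifP => [xB|/negbT xB].
  rewrite -mulrDr; apply: ler_wpM2l => //.
  have := @h_submod1 I (B :&: (I :\ x)) (I :\ x) x Iind (subsetIr _ _) (subD1set _ _) xI.
  rewrite -E2 !inE eqxx => /(_ isT).
  have -> : x |: (B :&: (I :\ x)) = B :&: I.
    apply/setP => y; rewrite !inE; case: eqP => [->|_] //=.
    by rewrite xB xI.
  lra.
rewrite addr0 (_ : B :&: (I :\ x) = B :&: I) //.
apply/setP => y; rewrite !inE; case: eqP => [->|_] //=.
by rewrite (negbTE xB).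
Qed.

Variable g : R.
Hypothesis g_ge0 : 0 <= g.
Hypothesis h_crude : forall D A, unlinked e D A ->
  h (D :|: A) - h D <= g ^+ #|A|.-1 * \sum_(x in A) (h (D :|: [set x]) - h D).

(** Starting from the isolated vertices, add the components one by one. Each is unlinked from the
    current [D], so [h_crude] applies, and submodularity moves the single-site increments from [D]
    back to [isolated A]. *)
Lemma le_isolated A : h A - h (isolated A) <=
  \sum_(u in A :\: isolated A) g ^+ #|component e A u|.-1 *
    (h (isolated A :|: [set u]) - h (isolated A)).
Proof.
set I := isolated A.
pose F u := g ^+ #|component e A u|.-1 * (h (I :|: [set u]) - h I).
suff H D : I \subset D -> D \subset A -> (forall u, u \in D -> component e A u \subset D) ->
    h A - h D <= \sum_(u in A :\: D) F u.
  apply: H => //; first exact: isolated_sub.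
  by move=> u uI; rewrite component_isolated // sub1set.
have [n] := ubnP #|A :\: D|; elim: n D => // n IH D Dn ID DA Dcl.
have [AD0|[u]] := set_0Vmem (A :\: D).
  rewrite AD0 big_set0 subr_le0 h_mono //.
  by rewrite -setD_eq0 AD0.
rewrite in_setD => /andP[uD uA]; set C := component e A u.
have CA : C \subset A by exact: component_sub.
have CD v : v \in C -> v \notin D.
  move=> vC; apply: contra uD => vD; apply: (subsetP (Dcl _ vD)).
  by rewrite (component_eq e_sym vC) component_refl.
have DC : unlinked e D C.
  apply/unlinkedP => x y xD yC; split; first by apply: contraTneq xD => ->; exact: CD.
  apply/negP => xy; have := CD x; rewrite xD => /(_ _)/negP; apply => //.
  apply: (component_edge uA yC); first exact: (subsetP DA).
  by rewrite e_sym.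
have uC : u \in C by exact: component_refl.
have split_sum : \sum_(v in A :\: D) F v =
    \sum_(v in C) F v + \sum_(v in A :\: (D :|: C)) F v.
  rewrite (big_setID C) /=; congr (_ + _); apply: eq_bigl => v.
    rewrite in_setI in_setD; have [vC|//] := boolP (v \in C); last by rewrite andbF.
    by rewrite (CD v vC) (subsetP CA).
  by rewrite !in_setD in_setU negb_or; case: (v \in D); rewrite ?andbF.
have := IH (D :|: C).
have lt : (#|A :\: (D :|: C)| < n)%N.
  rewrite ltnS in Dn; apply: leq_trans Dn; apply: proper_card; apply/properP; split.
    by apply: setDS; exact: subsetUl.
  by exists u; rewrite in_setD ?in_setU ?uD ?uA // uC orbT.
have cl v : v \in D :|: C -> component e A v \subset D :|: C.
  rewrite in_setU => /orP[vD|vC]; first by apply: subset_trans (Dcl _ vD) (subsetUl _ _).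
  by rewrite (component_eq e_sym vC) subsetUr.
move=> /(_ lt (subset_trans ID (subsetUl _ _)) _ cl).
rewrite subUset DA CA => /(_ isT) h1.
have h2 := h_crude DC.
have h3 : g ^+ #|C|.-1 * \sum_(x in C) (h (D :|: [set x]) - h D) <= \sum_(v in C) F v.
  rewrite mulr_sumr; apply: ler_sum => v vC.
  rewrite /F (component_eq e_sym vC); apply: ler_wpM2l; first exact: exprn_ge0.
  apply: h_submod => //; apply: unlinkedS DC => //.
  by rewrite sub1set.
by rewrite split_sum; lra.
Qed.

Variable th : R.
Hypothesis th_gt0 : 0 < th.
Hypothesis th_lt1 : th < 1.
Variable Delta : nat.
Hypothesis e_deg : forall x, (#|[set y | e x y]| <= Delta)%N.
Hypothesis subcritical : g * (th / (1 - th)) * Delta%:R ^+ 2 <= 2^-1.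

(* A non-isolated vertex u of A with component C is charged to the set
   A' = A minus (C minus u), in which u is isolated and which has weight
   (th / (1 - th))^-(#|C| - 1) times that of A. Each pair (A', u) receives at
   most the sum of (g th / (1 - th))^(#|C| - 1) over the connected C at u. *)
Lemma bernoulli_le_isolated :
  \sum_(A : {set V}) bern th A * h A <=
  2 * \sum_(A : {set V}) bern th A * h (isolated A).
Proof.
have th01 : 0 <= th <= 1 by rewrite !ltW.
have om0 : 0 < 1 - th by rewrite subr_gt0.
have b0 A : 0 <= bern th A by exact: bern_ge0.
set r := th / (1 - th).
have r0 : 0 <= r by rewrite divr_ge0 // ltW.
pose d u I := h (I :|: [set u]) - h I.
have d0 u I : 0 <= d u I by rewrite subr_ge0 h_mono // subsetUl.
(* The excess over the isolated part is at most that part, hence the factor 2. *)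
suff H : \sum_(A : {set V}) bern th A * (\sum_(u in A :\: isolated A)
     g ^+ #|component e A u|.-1 * d u (isolated A)) <=
   \sum_(A : {set V}) bern th A * h (isolated A).
  rewrite mulr_natl mulr2n -lerBlDr -sumrB; apply: le_trans H.
  by apply: ler_sum => A _; rewrite -mulrBr; apply: ler_wpM2l => //; exact: le_isolated.
(* The increments available at the isolated vertices of [A] sum to at most [h (isolated A)], by
   [drop_sum_independent_le]. *)
apply: (@le_trans _ _ (\sum_u \sum_(A : {set V} | u \in isolated A)
   bern th A * d u (isolated A :\ u))); last first.
  rewrite (exchange_big_dep xpredT) //=; apply: ler_sum => A _.
  rewrite -mulr_sumr; apply: ler_wpM2l => //.
  apply: le_trans (drop_sum_independent_le (independent_isolated e A)).
  rewrite le_eqVlt /drop_sum; apply/orP; left; apply/eqP; apply: eq_bigr => u uI.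
  by rewrite /d setUC setD1K.
under eq_bigr => A _ do rewrite mulr_sumr.
rewrite (exchange_big_dep xpredT) //=; apply: ler_sum => u _.
set X := \sum_(A | u \in isolated A) _.
have X0 : 0 <= X by apply: sumr_ge0 => A _; exact: mulr_ge0.
rewrite (partition_big (fun A => component e A u)
  (fun C => connected_at e u C && (1 < #|C|)%N)) /=; last first.
  move=> A; rewrite inE => /andP[uI uA]; apply/andP; split.
    by apply/existsP; exists A; rewrite uA eqxx.
  rewrite ltnNge; apply: contra uI => /card_le1P H1.
  apply/isolatedP; split=> // v vA; apply/negP => uv.
  have vC : v \in component e A u.
    exact: (component_edge uA (component_refl e A u) vA uv).
  have := H1 _ (component_refl e A u) v; rewrite vC inE => /esym/eqP vu.
  by move: uv; rewrite vu e_irr.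
apply: (@le_trans _ _ (\sum_(C : {set V} | connected_at e u C && (1 < #|C|)%N)
    (g * r) ^+ #|C|.-1 * X)); last first.
  rewrite -mulr_suml -[leRHS]mul1r; apply: ler_wpM2r => //.
  by apply: (sum_connected_at_le e_sym e_deg) => //; rewrite mulr_ge0.
apply: ler_sum => C /andP[_ C1].
pose phi A := A :\: (C :\ u).
pose P A := (u \in A :\: isolated A) && (component e A u == C).
rewrite exprMn -mulrA.
have E A : P A -> bern th A * (g ^+ #|component e A u|.-1 * d u (isolated A)) =
   g ^+ #|C|.-1 * (r ^+ #|C|.-1 * (bern th (phi A) * d u (isolated (phi A) :\ u))).
  move=> /andP[uAI /eqP AC]; move: uAI; rewrite inE => /andP[uI uA].
  have [_] := isolated_resample e_sym e_irr uA uI; rewrite AC -/(phi A) => ->.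
  suff -> : bern th A = r ^+ #|C|.-1 * bern th (phi A) by ring.
  have CA : C \subset A by rewrite -AC component_sub.
  have uC : u \in C by rewrite -AC component_refl.
  have CuA : C :\ u \subset A by apply: subset_trans CA; exact: subD1set.
  have Cu : #|C :\ u| = #|C|.-1 by rewrite (cardsD1 u C) uC.
  have c1 : #|A| = (#|C|.-1 + #|phi A|)%N.
    by rewrite /phi cardsDS // Cu subnKC // -Cu subset_leq_card.
  have c2 : #|~: phi A| = (#|C|.-1 + #|~: A|)%N.
    apply/eqP; rewrite -(eqn_add2l #|phi A|) cardsC -(cardsC A) c1.
    by rewrite addnA [X in _ == (X + _)%N]addnC.
  rewrite /bern c2 c1 !exprD /r expr_div_n; field.
  by rewrite expf_neq0 // gt_eqF.
rewrite (eq_bigr _ E) -!mulr_sumr; apply: ler_wpM2l; first exact: exprn_ge0.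
apply: ler_wpM2l; first exact: exprn_ge0.
(* [A] is recovered by adding [C :\ u] back, so for a fixed [C] no set is charged twice. *)
have inj : {in [set A | P A] &, injective phi}.
  move=> A B; rewrite !inE => /andP[uAI /eqP AC] /andP[uBI /eqP BC] AB.
  have uA : u \in A by move: uAI; rewrite inE => /andP[].
  have uB : u \in B by move: uBI; rewrite inE => /andP[].
  have CA : C :\ u \subset A.
    by rewrite -AC; apply: subset_trans (component_sub e uA); exact: subD1set.
  have CB : C :\ u \subset B.
    by rewrite -BC; apply: subset_trans (component_sub e uB); exact: subD1set.
  by rewrite -(setID A (C :\ u)) -(setID B (C :\ u)) -/(phi A) -/(phi B) AB !(setIidPr _).
rewrite (eq_bigl (mem [set A | P A])) => [|A]; last by rewrite !inE /P inE.
rewrite -(big_imset (fun A => bern th A * d u (isolated A :\ u)) inj) /=.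
rewrite big_mkcond /X [leRHS]big_mkcond; apply: ler_sum => A _.
case: ifP => [/imsetP[B]|_]; last by case: ifP => // _; rewrite mulr_ge0.
rewrite inE => /andP[uBI /eqP BC] ->.
move: uBI; rewrite inE => /andP[uI uB].
have [] := isolated_resample e_sym e_irr uB uI; rewrite BC -/(phi B) => -> _.
exact: lexx.
Qed.

End IsolatedVertices.

(** * General block factorization *)

Section BlockFactorization.
Context {R : realType} {q : nat} {V W : finType}.
Variable S : spin_system R q V W.
Implicit Types (D A : {set V}) (s t u : Omega S) (f g : Omega S -> R).
Local Notation e := (interior_adj S).

Lemma interior_degree_le x : (#|[set y | e x y]| <= max_degree S)%N.
Proof.
apply: leq_trans (leq_bigmax (inl x : V + W)%type).
rewrite -(card_imset [set y | e x y] (@inl_inj V W)); apply/subset_leq_card/subsetP => y.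
by move=> /imsetP[z]; rewrite !inE => xz ->.
Qed.

Lemma delta_le (alpha : {set V} -> R) x :
  delta alpha <= \sum_(D : {set V} | x \in D) alpha D.
Proof. exact: bigmin_le. Qed.

Lemma delta_le1 (alpha : {set V} -> R) : delta alpha <= 1.
Proof. exact: bigmin_le_id. Qed.

Lemma delta_ge0 (alpha : {set V} -> R) : block_distribution alpha -> 0 <= delta alpha.
Proof. by move=> [a0 _]; apply: le_bigmin => // x _; apply: sumr_ge0. Qed.

Lemma shearer_mean_Ent_block I (alpha : {set V} -> R) f :
  block_distribution alpha -> (forall s, 0 <= f s) -> independent e I ->
  delta alpha * mean_Ent_block I f <= \sum_(D : {set V}) alpha D * mean_Ent_block D f.
Proof.
move=> [a0 a1] f0 Iind.
have mono D A : D \subset A -> mean_Ent_block D f <= mean_Ent_block A f.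
  by move=> DA; apply: mean_Ent_block_le.
apply: (le_trans (@shearer_independent_le R V e (fun D => mean_Ent_block D f)
  mono _ alpha (delta alpha) I a0 _ (delta_le alpha) Iind)).
- by move=> D' D A D'D DA; apply: mean_Ent_block_submod.
- exact: mean_Ent_block_set0.
- by apply: ler_sum => D _; apply: ler_wpM2l => //; apply: mono; exact: subsetIl.
Qed.

(** The increments over [D] are block entropies of the average of [f] over [D], to which the crude
    bound applies. For s >= 2 sites, 8 / b^(4 s + 1) <= (2 / b)^(12 (s - 1)); a single site needs no
    loss, so the exponent may start at 0. *)
Lemma crude_component_le D A f b : totally_connected S -> marginally_bounded S b ->
  b <= 1 -> (forall s, 0 <= f s) -> unlinked e D A ->
  mean_Ent_block (D :|: A) f - mean_Ent_block D f <=
  ((2 / b) ^+ 12) ^+ #|A|.-1 *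
    \sum_(x in A) (mean_Ent_block (D :|: [set x]) f - mean_Ent_block D f).
Proof.
move=> tc mb b1 f0 DA; have [b0 _] := mb.
have g0 s : 0 <= mean_block D f s by exact: mean_block_ge0.
have E x : x \in A -> mean_Ent_block (D :|: [set x]) f - mean_Ent_block D f =
    mean_Ent_block [set x] (mean_block D f).
  move=> xA; apply: mean_Ent_block_setU => //; apply: unlinkedS DA => //.
  by rewrite sub1set.
rewrite (eq_bigr _ E) mean_Ent_block_setU //.
have [A0|[x xA]] := set_0Vmem A.
  by rewrite A0 big_set0 mulr0 mean_Ent_block_set0.
case cA : #|A| => [|[|n]].
- by move: xA; rewrite (cards0_eq cA) inE.
- move/eqP/cards1P : cA => [y ->].
  by rewrite big_set1 expr0 mul1r.
apply: (le_trans (mean_Ent_block_le_sites A tc mb g0)).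
apply: ler_wpM2r; first by apply: sumr_ge0 => y _; exact: mean_Ent_block_ge0.
rewrite cA -exprM.
have x2 : 2 <= 2 / b by rewrite ler_peMr // invf_ge1.
have x1 : 1 <= 2 / b by lra.
apply: (@le_trans _ _ ((2 / b) ^+ (4 * n.+2).+1)); last first.
  by apply: ler_weXn2l => //; lia.
rewrite expr_div_n ler_pM2r ?invr_gt0 ?exprn_gt0 //.
rewrite (_ : 8 = 2 ^+ 3 :> R); last by rewrite !exprS expr0; ring.
by apply: ler_weXn2l; [lra | lia].
Qed.

Lemma general_block_factorization b eta : (0 < #|V|)%N -> inhabited (Omega S) ->
  totally_connected S -> spectrally_independent S eta -> marginally_bounded S b ->
  block_factorization S
    ((2 / b) `^ (64 * ((max_degree S)%:R * (1 + eta / b)))).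
Proof.
move=> V0 inh tc si mb alpha alphaP f f0.
have [b0 _] := mb; have b1 := marginal_bound_le1 inh V0 mb.
have eta0 := spectral_bound_ge0 inh V0 si.
have [a0 a1] := alphaP.
set Z := \sum_(D : {set V}) _; rewrite -mean_Ent_block_setT.
have Z0 : 0 <= Z by apply: sumr_ge0 => D _; apply: mulr_ge0 => //; exact: mean_Ent_block_ge0.
set x := 2 / b; have x2 : 2 <= x by rewrite ler_peMr // invf_ge1.
have x1 : 1 <= x by lra.
have x0 : 0 < x by lra.
set Delta := max_degree S.
(* Without edges the constant must be 1, and Shearer's inequality applies to all of [V]. *)
have [Delta0|DeltaP] := posnP Delta.
  rewrite Delta0 mul0r mulr0 powRr0 mul1r.
  apply: shearer_mean_Ent_block => //; apply/independentP => y z _ _.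
  apply/negP => yz; have := interior_degree_le y; rewrite -/Delta Delta0 leqn0 cards_eq0.
  by move/eqP/setP/(_ z); rewrite !inE yz.
(* Subcriticality reduces to 4 x^12 Delta^2 th <= 1; with 4 <= x^2 and Delta <= x^Delta it suffices
   that 14 + 2 Delta <= 16 Delta. *)
pose th := (x ^+ (16 * Delta))^-1.
have th0 : 0 < th by rewrite invr_gt0 exprn_gt0.
have th_half : th <= 2^-1.
  rewrite lef_pV2 ?posrE ?exprn_gt0 //; apply: (le_trans x2).
  have nD : (1 <= 16 * Delta)%N by move: DeltaP; clear; lia.
  by have := ler_weXn2l x1 nD; rewrite expr1.
have th1 : th < 1 by lra.
have th01 : 0 <= th <= 1 by rewrite !ltW.
(* The binomial argument needs an integer; rounding up adds at most 1. *)
pose N := (Num.truncn (1 + 4 * eta / b)).+1.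
have eb0 : 0 <= 4 * eta / b by rewrite divr_ge0 ?mulr_ge0 // ltW.
have N1 : 1 + 4 * eta / b <= N%:R by apply/ltW/truncnS_gt.
have N2 : N%:R <= 2 + 4 * eta / b.
  have /truncn_itv/andP[h _] : 0 <= 1 + 4 * eta / b by lra.
  by rewrite /N -natr1; lra.
pose h D := mean_Ent_block D f.
have h0 D : 0 <= h D by exact: mean_Ent_block_ge0.
have hmono D A : D \subset A -> h D <= h A by move=> DA; exact: mean_Ent_block_le.
have hsub D' D A : D' \subset D -> unlinked e D A ->
    h (D :|: A) - h D <= h (D' :|: A) - h D'.
  by move=> D'D DA; exact: mean_Ent_block_submod.
have hcrude D A : unlinked e D A -> h (D :|: A) - h D <=
    (x ^+ 12) ^+ #|A|.-1 * \sum_(y in A) (h (D :|: [set y]) - h D).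
  by move=> DA; exact: crude_component_le.
have hT D : drop_sum h D <= N%:R * h D.
  apply: le_trans (drop_sum_entropy_le inh eta0 si mb f0 D) _.
  by apply: ler_wpM2r; first exact: h0.
have sub : x ^+ 12 * (th / (1 - th)) * Delta%:R ^+ 2 <= 2^-1.
  have h1 : th / (1 - th) <= 2 * th.
    by rewrite ler_pdivrMr ?subr_gt0 //; nra.
  have h2 : Delta%:R <= x ^+ Delta.
    apply: (@le_trans _ _ (2 ^+ Delta)); first by rewrite -natrX ler_nat ltnW // ltn_expl.
    by apply: lerXn2r => //; rewrite nnegrE ltW.
  have h3 : Delta%:R ^+ 2 <= x ^+ (2 * Delta).
    rewrite mulnC exprM; apply: lerXn2r => //; rewrite nnegrE ?ler0n //.
    by rewrite exprn_ge0 // ltW.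
  apply: (@le_trans _ _ (x ^+ 12 * (2 * th) * x ^+ (2 * Delta))).
    have xp n : 0 <= x ^+ n by rewrite exprn_ge0 // ltW.
    have c0 : 0 <= x ^+ 12 * (2 * th) by rewrite mulr_ge0 // mulr_ge0 // ltW.
    apply: le_trans (ler_wpM2l c0 h3).
    by apply: ler_wpM2r; [exact: sqr_ge0 | exact: (ler_wpM2l (xp _) h1)].
  rewrite -[leRHS]mul1r ler_pdivlMr //.
  have -> : x ^+ 12 * (2 * th) * x ^+ (2 * Delta) * 2 =
      2 * 2 * x ^+ 12 * x ^+ (2 * Delta) * th by ring.
  rewrite /th ler_pdivrMr ?exprn_gt0 // mul1r.
  apply: (@le_trans _ _ (x ^+ 2 * x ^+ 12 * x ^+ (2 * Delta))).
    have xp n : 0 <= x ^+ n by rewrite exprn_ge0 // ltW.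
    do 2 (apply: ler_wpM2r; first exact: xp).
    by rewrite expr2; apply: ler_pM.
  have nD : (2 + 12 + 2 * Delta <= 16 * Delta)%N by move: DeltaP; clear; lia.
  by have := ler_weXn2l x1 nD; rewrite 2!exprD.
have B1 := bernoulli_sum_ge th01 h0 hT.
have B2 : \sum_(A : {set V}) bern th A * h A <=
    2 * \sum_(A : {set V}) bern th A * h (isolated_vertices e A).
  apply: (bernoulli_le_isolated (interior_adj_sym S) (interior_adj_irr S) h0 hmono hsub _
    hcrude th0 th1 interior_degree_le sub).
  by rewrite exprn_ge0 // ltW.
have B3 : delta alpha * (\sum_(A : {set V}) bern th A * h (isolated_vertices e A)) <= Z.
  rewrite -[leRHS]mul1r -(bern_sum (V := V) th) mulr_suml mulr_sumr.
  apply: ler_sum => A _; rewrite mulrCA; apply: ler_wpM2l; first exact: bern_ge0.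
  by apply: shearer_mean_Ent_block => //; exact: independent_isolated.
have d0 := delta_ge0 alphaP.
have B4 : th ^+ N * (delta alpha * h setT) <= 2 * Z.
  rewrite mulrCA; apply: le_trans (ler_wpM2l d0 (le_trans B1 B2)) _.
  by rewrite mulrCA; apply: ler_wpM2l.
have B5 : delta alpha * h setT <= 2 * x ^+ (16 * Delta * N) * Z.
  have thN : th ^+ N = (x ^+ (16 * Delta * N))^-1 by rewrite /th exprVn -exprM.
  move: B4; rewrite thN (ler_pdivrMl _ _ (exprn_gt0 _ x0)) => B4.
  by rewrite -mulrA mulrCA.
apply: (le_trans B5); apply: ler_wpM2r => //.
(* The factor 2 is absorbed by one more [x], and 1 + 16 Delta (2 + 4 eta / b) <= 64 Delta (1 + eta /
   b) as Delta >= 1. *)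
apply: (@le_trans _ _ (x `^ ((16 * Delta * N).+1)%:R)).
  rewrite powR_mulrn ?(ltW x0) // exprS; apply: ler_wpM2r => //.
  by rewrite exprn_ge0 // ltW.
apply: ler_powR => //.
have D1 : 1 <= Delta%:R :> R by rewrite ler1n.
rewrite -natr1 !natrM.
have eb : 0 <= eta / b by rewrite divr_ge0 // ltW.
have N3 : N%:R <= 2 + 4 * (eta / b) by rewrite mulrA.
move: (ler_wpM2l (le_trans ler01 D1) N3) (mulr_ge0 (le_trans ler01 D1) eb) (D1).
by clear; lra.
Qed.

End BlockFactorization.

(** * Entropy decay of the block dynamics *)

Section Dynamics.
Context {R : realType} {q : nat} {V W : finType}.
Variable S : spin_system R q V W.
Implicit Types (D A : {set V}) (s t u : Omega S) (f g : Omega S -> R).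
Variable alpha : {set V} -> R.
Hypothesis alphaP : block_distribution alpha.
Local Notation P := (block_dynamics S alpha).
Local Notation mu_pos := (@mu_gt0 R q V W S).

Let alpha0 D : 0 <= alpha D. Proof. by case: alphaP. Qed.
Let alpha1 : \sum_D alpha D = 1. Proof. by case: alphaP. Qed.

Definition block_average f s : R := \sum_(D : {set V}) alpha D * mean_block D f s.

Lemma block_averageE f s : \sum_t P s t * f t = block_average f s.
Proof.
rewrite /block_dynamics /block_average.
under eq_bigr => t _ do rewrite mulr_suml.
rewrite exchange_big; apply: eq_bigr => D _; rewrite /mean_block mulr_sumr.
by apply: eq_bigr => t _; rewrite mulrA.
Qed.

Lemma mean_blockK D f : mean (mean_block D f) = mean f.
Proof.
by rewrite mean_blockF; apply: (expect_cexp mu_pos); exact: agree_off_equiv.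
Qed.

Lemma mean_average f : mean (block_average f) = mean f.
Proof.
transitivity (\sum_(D : {set V}) alpha D * mean (mean_block D f)).
  rewrite /mean /block_average.
  under eq_bigr => s _ do rewrite mulr_sumr.
  rewrite exchange_big; apply: eq_bigr => D _; rewrite mulr_sumr.
  by apply: eq_bigr => s _; rewrite mulrCA.
under eq_bigr => D _ do rewrite mean_blockK.
by rewrite -mulr_suml alpha1 mul1r.
Qed.

Lemma block_average_ge0 f s : (forall s, 0 <= f s) -> 0 <= block_average f s.
Proof. by move=> f0; apply: sumr_ge0 => D _; rewrite mulr_ge0 // mean_block_ge0. Qed.

Lemma Ent_mean_block D f : (forall s, 0 <= f s) ->
  Ent (mean_block D f) = Ent f - mean_Ent_block D f.
Proof.
by move=> f0; rewrite -!mean_Ent_block_setT mean_Ent_block_chain // finset.subsetT.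
Qed.

Lemma mean_gt0 f s : (forall s, 0 <= f s) -> 0 < f s -> 0 < mean f.
Proof.
move=> f0 fs; rewrite /mean (bigD1 s) //=; apply: ltr_wpDr.
  by apply: sumr_ge0 => t _; rewrite mulr_ge0 // ltW // mu_pos.
by rewrite mulr_gt0 // mu_pos.
Qed.

Lemma Ent_average_le f : (forall s, 0 <= f s) ->
  Ent (block_average f) <= Ent f - \sum_(D : {set V}) alpha D * mean_Ent_block D f.
Proof.
move=> f0.
have -> : Ent f - \sum_(D : {set V}) alpha D * mean_Ent_block D f =
    \sum_(D : {set V}) alpha D * Ent (mean_block D f).
  rewrite -{1}[Ent f]mul1r -alpha1 mulr_suml -sumrB; apply: eq_bigr => D _.
  by rewrite Ent_mean_block // mulrBr.
rewrite /Ent mean_average.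
have -> : \sum_(D : {set V}) alpha D *
     mean (fun s => mean_block D f s * ln (mean_block D f s / mean (mean_block D f))) =
   mean (fun s => \sum_(D : {set V}) alpha D *
     (mean_block D f s * ln (mean_block D f s / mean f))).
  rewrite /mean; under [RHS]eq_bigr => s _ do rewrite mulr_sumr.
  rewrite exchange_big; apply: eq_bigr => D _ /=; rewrite mulr_sumr.
  apply: eq_bigr => s _; rewrite -/(mean f) -/(mean (mean_block D f)) mean_blockK.
  by rewrite mulrCA.
apply: le_expect => [|s]; first exact: mu_pos.
set F := block_average f s.
have F0 : 0 <= F by exact: block_average_ge0.
(* Tangent of y ln y at the average [F]: the terms y - F have weighted sum 0. *)
have -> : F * ln (F / mean f) = \sum_(D : {set V})
    alpha D * (mean_block D f s * ln (F / mean f) + (mean_block D f s - F)).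
  under eq_bigr => D _ do rewrite mulrDr mulrBr mulrA.
  by rewrite big_split sumrB -!mulr_suml alpha1 -/(block_average f s) -/F /= mul1r subrr addr0.
apply: ler_sum => D _.
have [->|aD] := eqVneq (alpha D) 0; first by rewrite !mul0r.
apply: ler_wpM2l => //; set y := mean_block D f s.
have y0 : 0 <= y by exact: mean_block_ge0.
have aDp : 0 < alpha D by rewrite lt_neqAle eq_sym aD alpha0.
have yF : 0 < y -> 0 < F.
  move=> yp; apply: (@lt_le_trans _ _ (alpha D * y)); first exact: mulr_gt0.
  rewrite /F /block_average (bigD1 D) //= lerDl; apply: sumr_ge0 => B _.
  by rewrite mulr_ge0 // mean_block_ge0.
have := xlnx_div_ge_sub y0 F0 yF.
have [y00|yn0] := eqVneq y 0; first by move=> _; rewrite y00 !mul0r add0r sub0r oppr_le0.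
have yp : 0 < y by rewrite lt_neqAle eq_sym yn0.
have mp : 0 < mean f.
  rewrite -(mean_blockK D f); apply: (mean_gt0 _ yp) => t; exact: mean_block_ge0.
have Fp := yF yp.
by rewrite !ln_div ?posrE //; lra.
Qed.

Lemma mu_block_reversible D s t : mu s * mu_block D s t = mu t * mu_block D t s.
Proof.
rewrite /mu_block agree_off_sym; case: ifP => [ts|_]; last by rewrite !mulr0.
have -> : Pr (agree_off D s) = Pr (agree_off D t).
  by apply/esym; exact: (cmass_class _ (agree_off_equiv D) ts).
by rewrite mulrCA.
Qed.

Lemma block_dynamics_reversible s t : mu s * P s t = mu t * P t s.
Proof.
rewrite /block_dynamics !mulr_sumr; apply: eq_bigr => D _.
by rewrite mulrCA mu_block_reversible mulrCA.
Qed.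

Lemma kernel_iterSr n s t :
  kernel_iter P n.+1 s t = \sum_u kernel_iter P n s u * P u t.
Proof.
have KS m w : kernel_iter P m.+1 w t = \sum_u P w u * kernel_iter P m u t by [].
elim: n s => [|n IH] s.
  rewrite /= (bigD1 t) //= eqxx mulr1 big1 ?addr0 => [|u /negbTE ut]; last first.
    by rewrite ut mulr0.
  rewrite (bigD1 s) //= eqxx mul1r big1 ?addr0 // => u.
  by rewrite eq_sym => /negbTE ->; rewrite mul0r.
rewrite KS; under eq_bigr => u _ do rewrite IH mulr_sumr.
rewrite exchange_big; apply: eq_bigr => u _; rewrite [kernel_iter P n.+1 s u]/=.
rewrite mulr_suml.
by apply: eq_bigr => w _; rewrite mulrA.
Qed.

Definition density n s t : R := kernel_iter P n s t / mu t.

(** By reversibility the density evolves under the averaging operator itself, so the entropy decay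
    can be iterated. *)
Lemma densityS n s : density n.+1 s = block_average (density n s).
Proof.
apply/funext => t; rewrite -block_averageE /density kernel_iterSr mulr_suml.
apply: eq_bigr => u _; have := block_dynamics_reversible u t.
have := mu_pos t; have := mu_pos u => u0 t0 e.
have -> : P u t = mu t * P t u / mu u by rewrite -e mulrC mulKf // gt_eqF.
by field; rewrite !gt_eqF.
Qed.

Lemma mu_block_ge0 D s t : 0 <= mu_block D s t.
Proof.
rewrite /mu_block; case: ifP => // _; apply: divr_ge0; first exact: ltW (mu_pos t).
by apply: sumr_ge0 => u _; exact: ltW (mu_pos u).
Qed.

Lemma block_dynamics_ge0 s t : 0 <= P s t.
Proof. by apply: sumr_ge0 => D _; rewrite mulr_ge0 // mu_block_ge0. Qed.

Lemma density_ge0 n s t : 0 <= density n s t.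
Proof.
rewrite /density divr_ge0 //; last exact: ltW (mu_pos t).
elim: n s => [|n IH] s /=; first by rewrite ler0n.
by apply: sumr_ge0 => u _; rewrite mulr_ge0 // block_dynamics_ge0.
Qed.

Lemma mean_density n s : mean (density n s) = 1.
Proof.
elim: n => [|n IH]; last by rewrite densityS mean_average.
rewrite /mean (bigD1 s) //= /density /= eqxx big1 ?addr0 => [|t].
  by rewrite mulrC divfK // gt_eqF // mu_pos.
by rewrite eq_sym => /negbTE ->; rewrite mul0r mulr0.
Qed.

Lemma Ent_density0 s : Ent (density 0 s) = - ln (mu s).
Proof.
rewrite /Ent mean_density /mean (bigD1 s) //= big1 ?addr0 => [|t].
  have s0 := mu_pos s; rewrite /density /= eqxx divr1 div1r lnV ?posrE //.
  by rewrite mulrA divff ?mul1r // gt_eqF.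
by rewrite /density /= eq_sym => /negbTE ->; rewrite !mul0r mulr0.
Qed.

Lemma tv_le_quarter n s : Ent (density n s) <= 16^-1 -> tv_to_mu P n s <= 4^-1.
Proof.
set f := density n s => E16.
have f0 t : 0 <= f t by exact: density_ge0.
have mf : mean f = 1 by exact: mean_density.
have -> : tv_to_mu P n s = 2^-1 * mean (fun t => `|f t - 1|).
  rewrite /tv_to_mu; congr (_ * _); apply: eq_bigr => t _.
  have t0 := mu_pos t; rewrite -{2}(gtr0_norm t0) -normrM mulrBr mulr1.
  by rewrite /f /density mulrC divfK // gt_eqF.
suff : mean (fun t => `|f t - 1|) <= 2^-1 by lra.
(* With a = sqrt (f t): 2 |a - 1| (a + 1) <= 8 (a - 1)^2 + (a + 1)^2 / 8, while
   (a - 1)^2 is at most f ln f - f + 1. *)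
have h t : `|f t - 1| <= 4 * (f t * ln (f t / mean f) - f t + 1) + 8^-1 * (f t + 1).
  rewrite mf; have := xlnx_div_ge_sqrt (f0 t) ler01 (fun _ => ltr01).
  set X := f t * _; rewrite sqrtr1 mulr1 => hX.
  have s0 : 0 <= Num.sqrt (f t) by rewrite sqrtr_ge0.
  have sE : Num.sqrt (f t) ^+ 2 = f t by rewrite sqr_sqrtr.
  set a := Num.sqrt (f t) in hX s0 sE.
  have -> : `|f t - 1| = `|a - 1| * (a + 1).
    by rewrite -[in RHS](ger0_norm (addr_ge0 s0 ler01)) -normrM -subr_sqr expr1n sE.
  have sq : `|a - 1| ^+ 2 = f t - 2 * a + 1.
    by rewrite real_normK ?num_real // sqrrB sE; ring.
  have := sqr_ge0 (8 * `|a - 1| - (a + 1)); have := sqr_ge0 (a - 1).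
  rewrite !(sqrrB, sqrrD) exprMn sq !sE; nra.
apply: le_trans (le_expect mu_pos h) _.
rewrite expectD !expectZ.
have ef : expect (@mu _ _ _ _ S) f = 1 by exact: mf.
have ec : expect (@mu _ _ _ _ S) (fun=> 1) = 1.
  by rewrite /expect; under eq_bigr => t _ do rewrite mulr1; rewrite (mu_sum s).
have e1 : expect (@mu _ _ _ _ S) (fun t => f t + 1) = 2 by rewrite expectD ef ec.
have e2 : expect (@mu _ _ _ _ S) (fun t => f t * ln (f t / mean f) - f t + 1) = Ent f.
  by rewrite expectD expectB ef ec subrK.
(* The threshold 1/16 makes 4 / 16 + 2 / 8 equal to 1/2. *)
by rewrite e1 e2; lra.
Qed.

Section Decay.
Variable C : R.
Hypothesis C1 : 1 <= C.
Hypothesis factC : block_factorization S C.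

Lemma Ent_density_le n s :
  Ent (density n s) <= (1 - delta alpha / C) ^+ n * - ln (mu s).
Proof.
have C0 : 0 < C by exact: lt_le_trans ltr01 C1.
have d1 : delta alpha / C <= 1.
  by rewrite ler_pdivrMr // mul1r (le_trans (delta_le1 _)).
elim: n => [|n IH]; first by rewrite expr0 mul1r Ent_density0.
have f0 := density_ge0 n s.
rewrite densityS; apply: le_trans (Ent_average_le f0) _.
have := factC alphaP f0; set Z := \sum_D _ => H.
have H2 : delta alpha / C * Ent (density n s) <= Z.
  by rewrite mulrAC ler_pdivrMr // [leRHS]mulrC.
rewrite exprS -mulrA.
have := ler_wpM2l (_ : 0 <= 1 - delta alpha / C) IH; rewrite subr_ge0 => /(_ d1); lra.
Qed.

Lemma exists_mixing_step b s : marginally_bounded S b -> b <= 1 ->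
  0 < delta alpha -> (2 <= #|V|)%N ->
  exists2 n, tv_to_mu P n s <= 4^-1 &
   n%:R <= (C * (1 + ln (16 * (1 - ln b)) / ln 2) + (ln 2)^-1) * (delta alpha)^-1 *
     ln #|V|%:R.
Proof.
move=> mb b1 d0 V2; have [b0 _] := mb; have C0 : 0 < C by exact: lt_le_trans ltr01 C1.
have lnb : ln b <= 0 by exact: ln_le0.
set L := 1 - ln b; have L1 : 1 <= L by rewrite /L; lra.
set nV := #|V|%:R; have nV2 : 2 <= nV by rewrite ler_nat.
have ln2 : 0 < ln 2 :> R by rewrite ln_gt0 // ltr1n.
have lnn : ln 2 <= ln nV by rewrite ler_ln ?posrE //; lra.
set rho := delta alpha / C; have rho0 : 0 < rho by rewrite divr_gt0.
have rho1 : rho <= 1 by rewrite ler_pdivrMr // mul1r (le_trans (delta_le1 _)).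
(* [nV * L] bounds [- ln (mu s)], so a decay factor [X^-1] leaves entropy at most 1/16. The 1 in [L]
   keeps [X] at least 1 even for b = 1. *)
set X := 16 * nV * L.
have X0 : 0 < X by rewrite !mulr_gt0 //; lra.
have X1 : 1 <= X by rewrite /X; nra.
have lnX : 0 <= ln X by exact: ln_ge0.
have [n nX Xn] : exists2 n : nat, ln X / rho <= n%:R & n%:R <= ln X / rho + 1.
  exists (Num.truncn (ln X / rho)).+1; first exact/ltW/truncnS_gt.
  rewrite -natr1 lerD2r.
  by have /truncn_itv/andP[] : 0 <= ln X / rho by rewrite divr_ge0 // ltW.
exists n.
  apply: tv_le_quarter; apply: le_trans (Ent_density_le n s) _.
  have h1 : (1 - rho) ^+ n <= X^-1.
    apply: (@le_trans _ _ (expR (- rho * n%:R))).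
      rewrite mulrC expRM_natl; apply: lerXn2r; rewrite ?nnegrE ?subr_ge0 ?expR_ge0 //.
      exact: expR_ge1Dx.
    rewrite -[X in _ <= X^-1](lnK (x := X)) ?posrE // -expRN ler_expR mulNr lerN2.
    by rewrite mulrC -ler_pdivrMr.
  have h2 : - ln (mu s) <= nV * L.
    have := conditional_prob_ge mb (agree_offT s s).
    have -> : cmass (@mu _ _ _ _ S) (agree_off setT) s = 1.
      rewrite /cmass (eq_bigl xpredT) => [|u]; last by rewrite agree_offT.
      exact: mu_sum s.
    rewrite divr1 cardsT => h.
    have : ln (b ^+ #|V|) <= ln (mu s) by rewrite ler_ln ?posrE ?exprn_gt0 // mu_pos.
    rewrite lnXn // => h'; have : nV * ln b <= ln (mu s) by rewrite mulr_natl.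
    rewrite /L mulrBr mulr1 lerBrDr addrC => hb.
    by apply: (@le_trans _ _ 0); [rewrite subr_le0 | rewrite ler0n].
  apply: (@le_trans _ _ (X^-1 * (nV * L))).
    apply: (@le_trans _ _ ((1 - rho) ^+ n * (nV * L))).
      by apply: ler_wpM2l => //; rewrite exprn_ge0 // subr_ge0.
    by apply: ler_wpM2r => //; rewrite mulr_ge0 //; lra.
  rewrite le_eqVlt; apply/orP; left; apply/eqP; rewrite /X; field.
  by rewrite !gt_eqF //; lra.
(* Since ln 2 <= ln nV, a constant c is at most (c / ln 2) ln nV; this absorbs ln (16 L) and the 1
   lost in rounding [n]. *)
have lnXE : ln X = ln nV + ln (16 * L).
  by rewrite /X mulrAC mulrC lnM ?posrE ?mulr_gt0 //; lra.
have lnL : 0 <= ln (16 * L) by apply: ln_ge0; lra.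
apply: (le_trans Xn).
clear nX; set d := delta alpha in d0 rho rho0 rho1 Xn *.
have d1 : d <= 1 by exact: delta_le1.
have di : 1 <= d^-1 by rewrite invf_ge1.
have -> : ln X / rho = C * ln X * d^-1 by rewrite /rho; field; rewrite !gt_eqF.
set l2 := ln 2 in ln2 lnn *; set lV := ln nV in lnn lnXE *; set l16 := ln (16 * L) in lnXE lnL *.
have -> : (C * (1 + l16 / l2) + l2^-1) * d^-1 * lV =
    (C * lV + C * l16 * (lV / l2)) * d^-1 + lV / l2 * d^-1.
  by field; rewrite !gt_eqF.
have r1 : 1 <= lV / l2 by rewrite ler_pdivlMr // mul1r.
apply: lerD; last by rewrite -[leLHS]mulr1; apply: ler_pM.
rewrite lnXE mulrDr; apply: ler_wpM2r; first lra.
by rewrite lerD2l ler_peMr // mulr_ge0 // ltW.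
Qed.

Lemma mixing_time_le b : marginally_bounded S b -> b <= 1 ->
  0 < delta alpha -> (2 <= #|V|)%N ->
  (mixing_time P <= ((C * (1 + ln (16 * (1 - ln b)) / ln 2) + (ln 2)^-1) *
     (delta alpha)^-1 * ln #|V|%:R)%:E)%E.
Proof.
move=> mb b1 d0 V2; rewrite /mixing_time; apply: bigmax_le => [|s _].
  rewrite lee_fin; have [b0 _] := mb.
  have lnb : ln b <= 0 by exact: ln_le0.
  have ln2 : 0 < ln 2 :> R by rewrite ln_gt0 // ltr1n.
  have l16 : 0 <= ln (16 * (1 - ln b)) by apply: ln_ge0; lra.
  have lV : 0 <= ln #|V|%:R :> R by apply: ln_ge0; rewrite ler1n; lia.
  rewrite !mulr_ge0 ?invr_ge0 ?(ltW d0) // addr_ge0 ?invr_ge0 ?(ltW ln2) // mulr_ge0 //; first exact: le_trans ler01 C1.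
  by rewrite addr_ge0 // divr_ge0 // ltW.
have [n tv nle] := exists_mixing_step s mb b1 d0 V2.
apply: (@le_trans _ _ (n%:R)%:E); last by rewrite lee_fin.
by apply: ereal_inf_lbound; exists n.
Qed.

Lemma entropy_production_ge f : (forall s, 0 <= f s) ->
  ((\sum_(D : {set V}) alpha D * mean_Ent_block D f)%:E <= entropy_production P f)%E.
Proof.
move=> f0.
pose Y s := \sum_(D : {set V}) alpha D * ln (f s / mean_block D f s).
have -> : \sum_(D : {set V}) alpha D * mean_Ent_block D f =
    \sum_(s : Omega S) mu s * (f s * Y s).
  rewrite /mean_Ent_block /mean; under eq_bigr => D _ do rewrite mulr_sumr.
  rewrite exchange_big; apply: eq_bigr => s _ /=.
  by rewrite /Y !mulr_sumr; apply: eq_bigr => D _; ring.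
rewrite -sumEFin; apply: lee_sum => s _.
rewrite !EFinM; apply: lee_wpmul2l; first by rewrite lee_fin ltW // mu_pos.
have [fs0|fsn0] := eqVneq (f s) 0; first by rewrite fs0 !mul0e.
have fs : 0 < f s by rewrite lt_neqAle eq_sym fsn0 f0.
apply: lee_wpmul2l; first by rewrite lee_fin.
have m0 D : 0 < mean_block D f s.
  by rewrite mean_blockE; apply: cexp_gt0 => //; [exact: mu_pos|exact: agree_off_refl].
have -> : Y s = ln (f s) - \sum_(D : {set V}) alpha D * ln (mean_block D f s).
  rewrite -[ln (f s)]mul1r -alpha1 mulr_suml -sumrB; apply: eq_bigr => D _.
  by rewrite ln_div ?posrE // mulrBr.
rewrite EFinB lne_EFin //; apply: leeB => //.
(* Jensen through the tangent of ln at [mean_block D f s], which stays finite where [f t = 0]; its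
   linear part sums to 0 over [t]. *)
apply: (@le_trans _ _ (\sum_(t : Omega S) (\sum_(D : {set V}) alpha D * (mu_block D s t *
   (ln (mean_block D f s) + (f t / mean_block D f s - 1))))%:E)%E).
  apply: lee_sum => t _.
  have [ft0|ftn0] := eqVneq (f t) 0.
    rewrite ft0 le0_lneNy //.
    have [P0|Pn0] := eqVneq (P s t) 0.
      rewrite P0 mul0e lee_fin big1 // => D _; rewrite mulrA.
      have /eqP := P0; rewrite /block_dynamics psumr_eq0 => [/allP /(_ D)|B _].
        by rewrite mem_index_enum => /(_ isT) /eqP ->; rewrite mul0r.
      by rewrite mulr_ge0 // mu_block_ge0.
    have Pp : 0 < P s t by rewrite lt_neqAle eq_sym Pn0 block_dynamics_ge0.
    by rewrite gt0_muleNy ?lte_fin // leNye.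
  have ft : 0 < f t by rewrite lt_neqAle eq_sym ftn0 f0.
  rewrite lne_EFin // -EFinM lee_fin /block_dynamics mulr_suml; apply: ler_sum => D _.
  rewrite -mulrA; apply: ler_wpM2l => //; apply: ler_wpM2l; first exact: mu_block_ge0.
  have q0 : 0 < f t / mean_block D f s by rewrite divr_gt0.
  have := ln_le_subr1 q0; rewrite ln_div ?posrE //; lra.
rewrite sumEFin lee_fin exchange_big /=; apply: ler_sum => D _.
rewrite -mulr_sumr; apply: ler_wpM2l => //.
have k1 : \sum_t mu_block D s t = 1.
  have := cprob_sum mu_pos s (agree_off_refl D); rewrite big_mkcond => <-.
  by apply: eq_bigr => t _; rewrite /mu_block; case: ifP.
have -> : \sum_t mu_block D s t *
    (ln (mean_block D f s) + (f t / mean_block D f s - 1)) =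
    (\sum_t mu_block D s t) * (ln (mean_block D f s) - 1) +
    (\sum_t mu_block D s t * f t) / mean_block D f s.
  by rewrite !mulr_suml -big_split; apply: eq_bigr => t _ /=; ring.
rewrite k1 -/(mean_block D f s) divff ?gt_eqF //; lra.
Qed.

Lemma modified_log_sobolev_ge C' : C <= C' ->
  ((delta alpha / C')%:E <= modified_log_sobolev P)%E.
Proof.
move=> CC'; have C0 : 0 < C' by exact: lt_le_trans ltr01 (le_trans C1 CC').
apply: ereal_sup_ubound; exists (delta alpha / C') => // f f0.
apply: le_trans (entropy_production_ge f0); rewrite lee_fin.
rewrite mulrAC ler_pdivrMr // [leRHS]mulrC.
apply: le_trans (factC alphaP f0) _.
apply: ler_wpM2r => //.
by apply: sumr_ge0 => D _; rewrite mulr_ge0 // mean_Ent_block_ge0.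
Qed.

End Decay.
End Dynamics.

Theorem theorem1p7 (R : realType) :
  exists (K : R) (C C' : R -> R -> nat -> R),
  forall (q : nat) (V W : finType) (S : spin_system R q V W)
         (Delta : nat) (b eta : R),
    (2 <= q)%N ->
    (2 <= #|V|)%N ->
    inhabited (Omega S) ->
    totally_connected S ->
    max_degree S = Delta ->
    spectrally_independent S eta ->
    marginally_bounded S b ->
    [/\ exists2 e : R, `|e| <= K * (Delta%:R * (1 + eta / b)) &
          C b eta Delta = (2 / b) `^ e,
        block_factorization S (C b eta Delta),
        0 < C' b eta Delta &
        forall alpha : {set V} -> R, block_distribution alpha ->
          (0 < delta alpha ->
             (mixing_time (block_dynamics S alpha) <=
               (C' b eta Delta * (delta alpha)^-1 * ln #|V|%:R)%:E)%E) /\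
          ((delta alpha / C' b eta Delta)%:E <=
             modified_log_sobolev (block_dynamics S alpha))%E].
Proof.
(* The third witness below is the prefactor in [mixing_time_le]; it dominates [C], so it also serves
   for the modified log-Sobolev bound. *)
pose C (b eta : R) (Delta : nat) := (2 / b) `^ (64 * (Delta%:R * (1 + eta / b))).
exists 64, C, (fun b eta Delta =>
  C b eta Delta * (1 + ln (16 * (1 - ln b)) / ln 2) + (ln 2)^-1).
move=> q V W S Delta b eta _ V2 inh tc <- si mb.
have V0 : (0 < #|V|)%N by exact: ltnW.
have [b0 _] := mb; have b1 := marginal_bound_le1 inh V0 mb.
have eta0 := spectral_bound_ge0 inh V0 si.
have e0 : 0 <= 64 * ((max_degree S)%:R * (1 + eta / b)).
  by rewrite !mulr_ge0 // addr_ge0 // divr_ge0 // ltW.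
have CF := general_block_factorization V0 inh tc si mb.
(* This keeps the contraction factor 1 - delta alpha / C nonnegative. *)
have C1 : 1 <= C b eta (max_degree S).
  rewrite -[leLHS](powRr0 (2 / b)); apply: ler_powR => //.
  by rewrite ler_pdivlMr // mul1r (le_trans b1) // ler1n.
have lnb : ln b <= 0 by exact: ln_le0.
have ln2 : 0 < ln 2 :> R by rewrite ln_gt0 // ltr1n.
have l16 : 0 <= ln (16 * (1 - ln b)) by apply: ln_ge0; lra.
have r0 : 0 <= ln (16 * (1 - ln b)) / ln 2 by rewrite divr_ge0 // ltW.
have CC' : C b eta (max_degree S) <=
    C b eta (max_degree S) * (1 + ln (16 * (1 - ln b)) / ln 2) + (ln 2)^-1.
  rewrite mulrDr mulr1 -addrA lerDl addr_ge0 ?invr_ge0 ?(ltW ln2) // mulr_ge0 //.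
  exact: le_trans ler01 C1.
split => //.
- by exists (64 * ((max_degree S)%:R * (1 + eta / b))); rewrite ?ger0_norm.
- exact: lt_le_trans (lt_le_trans ltr01 C1) CC'.
- move=> alpha alphaP; split; last exact: modified_log_sobolev_ge CC'.
  by move=> d0; exact: mixing_time_le.
Qed.
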